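(* Let $X\subseteq\mathbb{C}^n$ be an irreducible variety, let $\mathcal{O}(X)\subseteq\mathbb{C}^n_y\times\mathbb{C}^1_\epsilon$ be its offset family, and let $f(y,\epsilon)$ be the defining polynomial of $\mathcal{O}(X)$. Then the degree of $f$ in the variable $\epsilon$ equals two times the Euclidean Distance degree of $X$: $$\deg_\epsilon f = 2\cdot \mathrm{EDdegree}(X).$$
   Context: For $x,y\in\mathbb{C}^n$ put $d(x,y)=\sum_{i=1}^n (x_i-y_i)^2$ (the complexification of the real squared Euclidean distance, not the Hermitian one). Orthogonality $\perp$ is with respect to the bilinear form $\sum_i u_iv_i$. $X_{reg}$ is the set of nonsingular points of $X$ and $T_xX$ the tangent space at $x$. The Euclidean Distance Degree correspondence is $\mathcal{E}(X)=\overline{\{(x,y): x\in X_{reg},\ x-y\perp T_xX\}}\subseteq\mathbb{C}^n_x\times\mathbb{C}^n_y$. $\mathrm{EDdegree}(X)$ is the cardinality of the fiber of the projection $\mathrm{pr}_y:\mathcal{E}(X)\to\mathbb{C}^n_y$ over a generic point $y_0\in\mathbb{C}^n_y$. For $\epsilon\in\mathbb{C}$, the offset correspondence is $\mathcal{OC}_\epsilon(X)=\mathcal{E}(X)\cap V(d(x,y)-\epsilon^2)$, and the $\epsilon$-offset hypersurface is $\mathcal{O}_\epsilon(X)=\overline{\mathrm{pr}_y(\mathcal{OC}_\epsilon(X))}\subseteq\mathbb{C}^n_y$. The offset family is $\mathcal{O}(X)=\overline{\{(y,\epsilon): y\in\mathcal{O}_\epsilon(X)\}}\subseteq\mathbb{C}^n_y\times\mathbb{C}^1_\epsilon$.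 Throughout, for generic $\epsilon$, $\mathcal{O}_\epsilon(X)$ is a hypersurface in $\mathbb{C}^n_y$, and $\mathcal{O}(X)$ is a hypersurface in $\mathbb{C}^n_y\times\mathbb{C}^1_\epsilon$; its defining polynomial $f(y,\epsilon)$ is the squarefree generator of its ideal. *)

(* Defs.v *)
From HB Require Import structures.
From mathcomp Require Import all_boot all_order all_algebra.
From mathcomp Require Export complex mpoly.
From mathcomp Require Export boolp classical_sets cardinality reals.

Set Implicit Arguments.
Unset Strict Implicit.
Unset Printing Implicit Defensive.

Import GRing.Theory.

Local Open Scope ring_scope.
Local Open Scope classical_set_scope.

(* Points of affine n-space are row vectors x : 'rV[C]_n, and p.@[x 0] is the
   value at x of p : {mpoly C[n]}.  A pair (x, y) is row_mx x y.              *)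

Section AffineVarieties.
Variable C : fieldType.

Definition vanishing_ideal n (S : set 'rV[C]_n) : set {mpoly C[n]} :=
  [set p | forall x, S x -> p.@[x 0] = 0].

Definition zero_locus n (I : set {mpoly C[n]}) : set 'rV[C]_n :=
  [set x : 'rV[C]_n | forall p, I p -> p.@[x 0] = 0].

Definition zariski_closed n (S : set 'rV[C]_n) : Prop :=
  exists I : set {mpoly C[n]}, S = zero_locus I.

Definition zariski_closure n (S : set 'rV[C]_n) : set 'rV[C]_n :=
  zero_locus (vanishing_ideal S).

Definition irreducible_variety n (X : set 'rV[C]_n) : Prop :=
  [/\ zariski_closed X, X !=set0 &
      forall A B : set 'rV[C]_n, zariski_closed A -> zariski_closed B ->
        X `<=` A `|` B -> X `<=` A \/ X `<=` B].

(* P holds on a nonempty Zariski open subset of C^n; as C is infinite in the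
   intended use, the principal open set {g != 0} is nonempty when g != 0.    *)
Definition generically n (P : set 'rV[C]_n) : Prop :=
  exists2 g : {mpoly C[n]}, g != 0 & forall y : 'rV[C]_n, g.@[y 0] != 0 -> P y.

Definition hypersurface n (S : set 'rV[C]_n) : Prop :=
  exists2 g : {mpoly C[n]}, (1 < msize g)%N & S = [set x : 'rV[C]_n | g.@[x 0] = 0].

Definition squarefree_mpoly n (f : {mpoly C[n]}) : Prop :=
  forall g h : {mpoly C[n]}, f = g ^+ 2 * h -> (msize g <= 1)%N.

Definition defining_polynomial n (S : set 'rV[C]_n) (f : {mpoly C[n]}) : Prop :=
  squarefree_mpoly f /\
  vanishing_ideal S = [set p | exists q : {mpoly C[n]}, p = q * f].

Definition degree_in n (i : 'I_n) (f : {mpoly C[n]}) : nat :=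
  (\max_(m <- msupp f) m i)%N.

(* The classes of the g_i in the coordinate ring C[X] are algebraically
   independent over C.                                                      *)
Definition alg_independent_on n (X : set 'rV[C]_n) d
    (g : d.-tuple {mpoly C[n]}) : Prop :=
  forall P : {mpoly C[d]}, vanishing_ideal X (P \mPo g) -> P = 0.

(* dim X = d for irreducible X: the transcendence degree over C of the
   coordinate ring C[X], equivalently of its fraction field C(X).           *)
Definition has_dimension n (X : set 'rV[C]_n) (d : nat) : Prop :=
  (exists g : d.-tuple {mpoly C[n]}, alg_independent_on X g) /\
  (forall g : d.+1.-tuple {mpoly C[n]}, ~ alg_independent_on X g).

Definition tangent_space n (X : set 'rV[C]_n) (x : 'rV[C]_n) : set 'rV[C]_n :=
  [set v : 'rV[C]_n | forall p, vanishing_ideal X p ->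
             \sum_(i < n) (mderiv i p).@[x 0] * v 0 i = 0].

(* The points x of X with dim T_x X = dim X. *)
Definition regular_locus n (X : set 'rV[C]_n) : set 'rV[C]_n :=
  [set x | X x /\ exists V : {vspace 'rV[C]_n},
             tangent_space X x = [set v | v \in V] /\ has_dimension X (\dim V)].

End AffineVarieties.

Section Offsets.
Variables (C : fieldType) (n : nat).
Implicit Types (X : set 'rV[C]_n) (x y u v : 'rV[C]_n) (eps : C).

Definition sqdist x y : C := \sum_(i < n) (x 0 i - y 0 i) ^+ 2.

Definition orthogonal_to u (T : set 'rV[C]_n) : Prop :=
  forall v, T v -> \sum_(i < n) u 0 i * v 0 i = 0.

Definition ED_correspondence X : set 'rV[C]_(n + n) :=
  zariski_closure
    [set row_mx xy.1 xy.2 | xy in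
       [set xy : 'rV[C]_n * 'rV[C]_n |
          regular_locus X xy.1 /\
          orthogonal_to (xy.1 - xy.2) (tangent_space X xy.1)]].

(* The value 0 is a default, used only if no m is the generic cardinality.   *)
Definition EDdegree X : nat :=
  xget 0%N [set m : nat | generically
    [set y0 | ([set z | ED_correspondence X z /\ rsubmx z = y0] #= `I_m)%card]].

Definition offset_correspondence X eps : set 'rV[C]_(n + n) :=
  ED_correspondence X `&` [set z | sqdist (lsubmx z) (rsubmx z) - eps ^+ 2 = 0].

Definition offset X eps : set 'rV[C]_n :=
  zariski_closure [set rsubmx z | z in offset_correspondence X eps].

Definition offset_family X : set 'rV[C]_(n + 1) :=
  zariski_closure
    [set row_mx ye.1 (const_mx ye.2) | ye in
       [set ye : 'rV[C]_n * C | offset X ye.2 ye.1]].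

Definition eps_index : 'I_(n + 1) := rshift n ord0.

End Offsets.

(* Main.v *)
(* Let [S] be the set of pairs [(x, y)] with [x] regular and [x - y] normal to [X] at [x],
   so that [E] is the closure of [S]. A normal vector at [x] is a gradient [grad q x] with
   [q] in [I(X)], and the regular points form an open subset of [X]; hence [I(S)] is prime.
   Let [L] be the fraction field of [C[x, y] / I(S)] and [d] the class of the squared
   distance in [L].

   If the coordinates [y] are algebraically dependent in [L], some [P(y) <> 0] vanishes on
   [E], so that both sides are zero. Otherwise, as the offset family is a hypersurface, [d]
   is algebraic over [C(y)]; let [G(y, T)] be a nonzero relation of [d] of minimal degree
   [m] in [T]. Splitting a polynomial in [eps] into its even and odd parts shows that the
   ideal of the offset family consists of the [h0(y, eps^2) + eps h1(y, eps^2)] with [h0]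
   and [h1] relations of [d] (this uses [d <> 0], which holds since otherwise all offsets
   with [eps <> 0] are empty). Hence [deg_eps f = 2 m].

   The gradient in [y] of the squared distance along [E] is [2 (y - x)], because [x - y] is
   normal to the motion of [x]. Differentiating [G(y, d) = 0] thus yields
   [2 G'(y, d) (x - y) = grad_y G (y, d)], so [x] is a rational function of [y] and [d], and
   the fiber of [E] over a generic [y0] is in bijection with the [m] simple roots of
   [G(y0, T)]. *)
Require Import Defs.
From HB Require Import structures.
From mathcomp Require Import all_boot all_order all_algebra.
From mathcomp Require Import generic_quotient ring_quotient fraction separable.
From mathcomp Require Import ring zify.
From mathcomp Require Import complex mpoly boolp classical_sets cardinality reals.

Set Implicit Arguments.
Unset Strict Implicit.
Unset Printing Implicit Defensive.

Import GRing.Theory Num.Theory.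

Local Open Scope ring_scope.
Local Open Scope classical_set_scope.

(** * The generic point of an irreducible set *)

Section PrimeIdealField.
Local Open Scope quotient_scope.
Variables (A : comNzRingType) (I : A -> Prop).
Hypotheses (I0 : I 0) (I1 : ~ I 1).
Hypothesis ID : forall a x y, I x -> I y -> I (a * x + y).
Hypothesis IM : forall x y, I (x * y) -> I x \/ I y.

Definition asbool_ideal (x : A) : bool := `[< I x >].

Lemma asbool_ideal_closed : idealr_closed asbool_ideal.
Proof.
split; [exact/asboolP | exact/asboolP |].
by move=> a x y /asboolP Ix /asboolP Iy; apply/asboolP/ID.
Qed.
HB.instance Definition _ := isIdealr.Build A asbool_ideal asbool_ideal_closed.

Lemma asbool_ideal_prime : prime_idealr_closed asbool_ideal.
Proof.
by move=> x y /asboolP /IM[]/asboolP h; apply/orP; [left|right].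
Qed.
HB.instance Definition _ :=
  isPrimeIdealrClosed.Build A asbool_ideal asbool_ideal_prime.

Definition classical_ideal : prime_idealr A := asbool_ideal.
Local Notation Q := {ideal_quot classical_ideal}.

Definition quot_unit : pred Q := fun x => `[< exists y, y * x = 1 >].

Definition quot_inv (x : Q) : Q := xget x [set y | y * x = 1].

Lemma quot_mulVr : {in quot_unit, left_inverse 1 quot_inv *%R}.
Proof.
by move=> x /asboolP[y yx]; rewrite /quot_inv; case: xgetP => // /(_ y).
Qed.

Lemma quot_unitP (x y : Q) : y * x = 1 -> quot_unit x.
Proof. by move=> yx; apply/asboolP; exists y. Qed.

Lemma quot_inv_out : {in [predC quot_unit], quot_inv =1 id}.
Proof.
move=> x /asboolP nu; rewrite /quot_inv; case: xgetP => // y _ yx.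
by case: nu; exists y.
Qed.

HB.instance Definition _ := GRing.ComNzRing_hasMulInverse.Build Q
  quot_mulVr quot_unitP quot_inv_out.
HB.instance Definition _ := GRing.ComUnitRing_isIntegral.Build Q
  (@Quotient.rquot_IdomainAxiom _ classical_ideal).

Lemma prime_ideal_field : exists (L : fieldType) (phi : {rmorphism A -> L}),
  forall a, phi a = 0 <-> I a.
Proof.
pose phi : {rmorphism A -> {fraction Q}} := (@tofrac Q \o \pi_Q)%FUN.
exists {fraction Q}, phi => a; rewrite /phi /=.
have E : \pi_Q a = 0 <-> I a.
  have pi0 : \pi_Q (0 : A) = 0 :> Q by exact: rmorph0.
  rewrite -pi0 (rwP eqP) -Quotient.idealrBE subr0.
  by split=> [/asboolP|/asboolP].
rewrite -E; split=> [/eqP|->]; first by rewrite tofrac_eq0 => /eqP.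
by rewrite tofrac0.
Qed.

End PrimeIdealField.

(** * Extension of derivations *)

Definition derivation_along (A : comNzRingType) (L : fieldType)
    (iota delta : A -> L) : Prop :=
  [/\ {morph delta : a b / a + b},
      (forall a b, delta (a * b) = iota a * delta b + delta a * iota b) &
      forall a, iota a = 0 -> delta a = 0].

Section ExtendDerivation.
Variables (A : comNzRingType) (L : fieldType).
Hypothesis L_char0 : forall k, k.+1%:R != 0 :> L.
Variables (iota : {rmorphism A -> L}) (delta : A -> L).
Hypothesis delta_der : derivation_along iota delta.

Let deltaD : {morph delta : a b / a + b}.
Proof. by case: delta_der => h _ _; exact: h. Qed.
Let deltaM a b : delta (a * b) = iota a * delta b + delta a * iota b.
Proof. by case: delta_der => _ h _; exact: h. Qed.
Let delta_ker a : iota a = 0 -> delta a = 0.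
Proof. by case: delta_der => _ _; apply. Qed.
Let delta0 : delta 0 = 0. Proof. by rewrite delta_ker ?rmorph0. Qed.

Let map_deltaD : {morph map_poly delta : p q / p + q}.
Proof.
by move=> p q; apply/polyP => i; rewrite coefD !coef_map_id0 // coefD deltaD.
Qed.

Let delta_sum I (r : seq I) (P : pred I) F :
  delta (\sum_(i <- r | P i) F i) = \sum_(i <- r | P i) delta (F i).
Proof. exact: (big_morph delta deltaD delta0). Qed.

Let map_deltaM p q : map_poly delta (p * q) =
  map_poly iota p * map_poly delta q + map_poly delta p * map_poly iota q.
Proof.
apply/polyP => i; rewrite coef_map_id0 // coefD !coefM delta_sum -big_split /=.
by apply: eq_bigr => k _; rewrite deltaM !coef_map_id0 ?rmorph0 //.
Qed.

Let map_delta_ker p : map_poly iota p = 0 -> map_poly delta p = 0.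
Proof.
move=> p0; apply/polyP => i; rewrite coef_map_id0 // coef0 delta_ker //.
by rewrite -coef_map p0 coef0.
Qed.

Variable z : L.

Definition eval_at (p : {poly A}) : L := horner_eval z (map_poly iota p).
HB.instance Definition _ := GRing.RMorphism.copy eval_at
  (horner_eval z \o map_poly iota).

Let eval_atB p q : eval_at (p - q) = eval_at p - eval_at q.
Proof. exact: rmorphB. Qed.

Let eval_atM p q : eval_at (p * q) = eval_at p * eval_at q.
Proof. exact: rmorphM. Qed.

Definition extend_by (w : L) (p : {poly A}) : L :=
  (map_poly delta p).[z] + (map_poly iota p^`()).[z] * w.

Let extD w : {morph extend_by w : p q / p + q}.
Proof.
by move=> p q; rewrite /extend_by map_deltaD derivD rmorphD !hornerD /=; ring.
Qed.

Let extM w p q :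
  extend_by w (p * q) = eval_at p * extend_by w q + extend_by w p * eval_at q.
Proof.
rewrite /extend_by /eval_at /horner_eval map_deltaM derivM rmorphD !rmorphM /=.
by rewrite !hornerD !hornerM; ring.
Qed.

Let coef_iota p i : (map_poly iota p)`_i = iota p`_i.
Proof. exact: coef_map. Qed.

Let size_map_pseudo (p P : {poly A}) :
  map_poly iota P != 0 -> (size (map_poly iota P) <= size (map_poly iota p))%N ->
  exists a b, iota a != 0 /\
    (size (map_poly iota (a *: p - b * P))%R < size (map_poly iota p))%N.
Proof.
move=> P0 sPp.
pose s := (size (map_poly iota P)).-1; pose t := (size (map_poly iota p)).-1.
exists P`_s, (p`_t *: 'X^(t - s)); split.
  by rewrite -coef_iota -lead_coefE lead_coef_eq0.
have p_gt0 : (0 < size (map_poly iota p))%N.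
  by apply: leq_trans sPp; rewrite size_poly_gt0.
have le_st : (s <= t)%N by rewrite /s /t; case: (size _) sPp p_gt0 => //=; lia.
rewrite -(ltn_predK p_gt0) ltnS; apply/leq_sizeP => j.
rewrite leq_eqVlt => /orP[/eqP<-|lt_tj].
  rewrite coef_iota coefB coefZ -scalerAl coefZ coefXnM.
  rewrite ltnNge leq_subr /= subKn // mulrC; first by rewrite subrr rmorph0.
rewrite coef_iota coefB coefZ -scalerAl coefZ coefXnM.
rewrite ifF; last by apply/negbTE; rewrite -leqNgt; lia.
rewrite rmorphB !rmorphM -[iota p`_j]coef_iota -[X in _ - _ * X]coef_iota.
rewrite [(map_poly iota p)`_j]nth_default; last first.
  exact: leq_trans (leqSpred _) lt_tj.
rewrite [(map_poly iota P)`_(j - _)]nth_default; first by rewrite !mulr0 subrr.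
have sP : (size (map_poly iota P) <= s.+1)%N by exact: leqSpred.
rewrite (leq_trans sP) //; move: lt_tj le_st; rewrite -/t; lia.
Qed.

(* If [z] is a root of [P] of minimal degree over the image of [iota], the value
   [w] at [z] is forced by differentiating [P(z) = 0]; [P'(z)] is nonzero by
   minimality. Pseudo-division by [P] then gives compatibility with the kernel. *)
Lemma extend_derivation : exists w, derivation_along eval_at (extend_by w).
Proof.
case: (pselect (exists P, eval_at P = 0 /\ map_poly iota P != 0)); last first.
  move=> tr; exists 0; split=> // p p0.
  have p'0 : map_poly iota p = 0.
    by apply/eqP/negPn/negP => np; case: tr; exists p.
  by rewrite /extend_by map_delta_ker // mulr0 addr0 horner0.
move=> exP.
have exs : exists s, `[< exists P,
    [/\ eval_at P = 0, map_poly iota P != 0 & size (map_poly iota P) = s] >].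
  by case: exP => P [P0 nP]; exists (size (map_poly iota P)); apply/asboolP; exists P.
case: (ex_minnP exs) => s /asboolP[P [P0 nP sP]] mins.
have minP p : eval_at p = 0 -> (size (map_poly iota p) < s)%N ->
    map_poly iota p = 0.
  move=> p0 lt_ps; apply/eqP/negPn/negP => np.
  suff : (s <= size (map_poly iota p))%N by rewrite leqNgt lt_ps.
  by apply: mins; apply/asboolP; exists p.
have P'0 : (map_poly iota P^`()).[z] != 0.
  apply/eqP => P'0; have: map_poly iota P^`() = 0.
    apply: minP => //; rewrite -deriv_map -sP; exact: lt_size_deriv.
  rewrite -deriv_map => dP0.
  have sP1 : (size (map_poly iota P) <= 1)%N.
    apply/leq_sizeP => -[//|j] _; have := congr1 (fun q : {poly L} => q`_j) dP0.
    rewrite coef_deriv coef0 -mulr_natl => /eqP; rewrite mulf_eq0.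
    by rewrite (negbTE (L_char0 _)) /= => /eqP.
  move: P0 nP; rewrite /eval_at /horner_eval (size1_polyC sP1) hornerC => ->.
  by rewrite eqxx.
pose w := - (map_poly delta P).[z] / (map_poly iota P^`()).[z].
have extP : extend_by w P = 0.
  by rewrite /extend_by /w mulrC divfK // subrr.
exists w; split=> //.
have pseudo n p : (size (map_poly iota p) < n)%N -> eval_at p = 0 ->
    exists a q, iota a != 0 /\ map_poly iota (a *: p - q * P) = 0.
  elim: n p => // n IHn p lt_pn p0.
  have [lt_ps|le_sp] := ltnP (size (map_poly iota p)) s.
    exists 1, 0; rewrite rmorph1 oner_neq0 scale1r mul0r subr0; split=> //.
    exact: minP.
  rewrite -sP in le_sp; have [a [b [a0 lt_p]]] := size_map_pseudo nP le_sp.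
  case: (IHn (a *: p - b * P)).
  - by apply: leq_trans lt_p _; rewrite -ltnS.
  - by rewrite -mul_polyC eval_atB !eval_atM p0 P0 !mulr0 subrr.
  move=> a' [q [a'0 H]]; exists (a' * a), (a' *: b + q); split.
    by rewrite rmorphM mulf_neq0.
  rewrite -[RHS]H; congr map_poly; rewrite scalerBr scalerA mulrDl -scalerAl.
  by rewrite opprD addrA.
move=> p p0; case: (pseudo _ p (ltnSn _) p0) => a [q [a0 r0]].
set r := a *: p - q * P in r0.
have extr : extend_by w r = 0.
  by rewrite /extend_by -deriv_map r0 map_delta_ker // deriv0 !horner0 mul0r addr0.
have : a%:P * p = r + q * P by rewrite /r subrK mul_polyC.
move/(congr1 (extend_by w)); rewrite extD !extM extr extP P0 p0 !mulr0 !addr0.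
rewrite /eval_at /horner_eval map_polyC /= hornerC => /eqP.
by rewrite mulf_eq0 (negbTE a0) => /eqP.
Qed.

End ExtendDerivation.

Lemma extend_derivation_seq (A : comNzRingType) (L : fieldType)
    (L_char0 : forall k, k.+1%:R != 0 :> L)
    (iota : {rmorphism A -> L}) (delta : A -> L) (zs : seq L) :
  derivation_along iota delta ->
  exists (B : comNzRingType) (j : {rmorphism A -> B}) (iota' : {rmorphism B -> L})
    (delta' : B -> L),
    [/\ derivation_along iota' delta', forall a, iota' (j a) = iota a,
        forall a, delta' (j a) = delta a &
        forall z, z \in zs -> exists b, iota' b = z].
Proof.
elim: zs A iota delta => [|z zs IHzs] A iota delta der.
  by exists A, idfun, iota, delta; split.
have [w der'] := extend_derivation L_char0 der z.
have [_ _ delta_ker] := der.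
case: (IHzs {poly A} (eval_at iota z) (extend_by iota delta z w)).
  exact: der'.
move=> B [j [iota' [delta' [derB jE deltaE gen]]]].
exists B, (j \o polyC), iota', delta'; split=> //.
- by move=> a /=; rewrite jE /= /eval_at /horner_eval map_polyC hornerC.
- move=> a /=; rewrite deltaE /extend_by derivC rmorph0 horner0 mul0r addr0.
  rewrite (_ : map_poly delta a%:P = (delta a)%:P) ?hornerC //.
  apply/polyP => i; rewrite coef_map_id0 ?coefC; last by rewrite delta_ker ?rmorph0.
  by case: eqP => // _; rewrite delta_ker ?rmorph0.
move=> x; rewrite inE => /orP[/eqP->|/gen //].
by exists (j 'X); rewrite jE /= /eval_at /horner_eval map_polyX hornerX.
Qed.

Lemma mderivXU n (C : nzRingType) (i k : 'I_n) :
  ('X_i : {mpoly C[n]})^`M(k) = (i == k)%:R.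
Proof.
rewrite mderivX mnm1E; case: eqP => [->|_]; last by rewrite scale0r.
by rewrite scale1r -{1}[U_(k)%MM]add0m addmK mpolyX0.
Qed.

Section MpolyRingInduction.
Variables (n : nat) (C : comNzRingType).

Lemma mpoly_ring_ind (P : {mpoly C[n]} -> Prop) :
  (forall c, P c%:MP) -> (forall i, P 'X_i) ->
  (forall p q, P p -> P q -> P (p + q)) ->
  (forall p q, P p -> P q -> P (p * q)) -> forall p, P p.
Proof.
move=> PC PX PD PM p; have P0 : P 0 by rewrite -mpolyC0.
have P1 : P 1 by rewrite -mpolyC1.
rewrite [p]mpolyE; apply: (big_ind P) => // m _.
rewrite -mul_mpolyC; apply: (PM) => //.
rewrite mpolyXE_id; apply: (big_ind P) => // i _.
by elim: (m i) => [|k IHk]; rewrite ?expr0 // exprS; apply: (PM).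
Qed.

Lemma mpoly_rmorph_ext (S : comNzRingType) (f g : {rmorphism {mpoly C[n]} -> S}) :
  (forall c, f c%:MP = g c%:MP) -> (forall i, f 'X_i = g 'X_i) -> f =1 g.
Proof.
move=> fgC fgX; elim/mpoly_ring_ind => // p q fgp fgq.
  by rewrite !rmorphD fgp fgq.
by rewrite !rmorphM fgp fgq.
Qed.

Lemma chain_rule (B : comNzRingType) (L : fieldType)
    (iota : {rmorphism B -> L}) (delta : B -> L)
    (f : {rmorphism {mpoly C[n]} -> B}) :
  {morph delta : a b / a + b} ->
  (forall a b, delta (a * b) = iota a * delta b + delta a * iota b) ->
  (forall c, delta (f c%:MP) = 0) ->
  forall p, delta (f p) = \sum_k iota (f p^`M(k)) * delta (f 'X_k).
Proof.
move=> deltaD deltaM deltaC.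
elim/mpoly_ring_ind => [c|i|p q IHp IHq|p q IHp IHq].
- rewrite deltaC big1 // => k _.
  by rewrite mderivC !rmorph0 mul0r.
- rewrite (bigD1 i) //= big1 => [|k ki].
    by rewrite mderivXU eqxx !rmorph1 mul1r addr0.
  by rewrite mderivXU eq_sym (negbTE ki) !rmorph0 mul0r.
- rewrite rmorphD deltaD IHp IHq -big_split; apply: eq_bigr => k _.
  by rewrite mderivD !rmorphD mulrDl.
rewrite rmorphM deltaM IHp IHq mulr_sumr mulr_suml -big_split /=.
apply: eq_bigr => k _; rewrite mderivM !rmorphD !rmorphM.
by ring.
Qed.

End MpolyRingInduction.

Lemma mpoly_derivation (C : fieldType) (N d : nat) (L : fieldType)
    (L_char0 : forall k, k.+1%:R != 0 :> L)
    (phi : {rmorphism {mpoly C[N]} -> L}) (g : d.-tuple {mpoly C[N]})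
    (g_indep : forall P : {mpoly C[d]}, phi (P \mPo g) = 0 -> P = 0) (i : 'I_d) :
  exists v : 'I_N -> L,
    (forall p, phi p = 0 -> \sum_k phi p^`M(k) * v k = 0) /\
    forall j, \sum_k phi (tnth g j)^`M(k) * v k = (i == j)%:R.
Proof.
pose iota : {rmorphism {mpoly C[d]} -> L} := (phi \o comp_mpoly g)%FUN.
pose delta (P : {mpoly C[d]}) := iota P^`M(i).
have der : derivation_along iota delta.
  split=> [P Q|P Q|P /g_indep->].
  - by rewrite /delta mderivD rmorphD.
  - by rewrite /delta mderivM rmorphD !rmorphM addrC.
  by rewrite /delta mderiv0 rmorph0.
case: (extend_derivation_seq L_char0 [seq phi 'X_k | k : 'I_N] der).
move=> B [j [iota' [delta' [derB iotaj deltaj gen]]]].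
have /choice[b bE] : forall k : 'I_N, exists b, iota' b = phi 'X_k.
  by move=> k; apply: gen; exact: (codom_f (fun k : 'I_N => phi 'X_k)).
pose psi : {rmorphism {mpoly C[N]} -> B} := mmap (j \o @mpolyC d C)%FUN b.
have psiC c : psi c%:MP = j c%:MP by rewrite /psi /= mmapC.
have psiX k : psi 'X_k = b k by rewrite /psi /= mmapX mmap1U.
have iotaC c : iota c%:MP = phi c%:MP by rewrite /iota /= comp_mpolyC.
have iota_psi p : iota' (psi p) = phi p.
  apply: (mpoly_rmorph_ext (f := (iota' \o psi)%FUN)) => [c|k] /=.
    by rewrite psiC iotaj iotaC.
  by rewrite psiX bE.
have [deltaD deltaM delta_ker] := derB.
have deltaC c : delta' (psi c%:MP) = 0.
  by rewrite psiC deltaj /delta mderivC rmorph0.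
have delta_psi p : delta' (psi p) = \sum_k phi p^`M(k) * delta' (b k).
  rewrite (chain_rule deltaD deltaM deltaC).
  by apply: eq_bigr => k _; rewrite iota_psi psiX.
exists (fun k => delta' (b k)); split=> [p p0|l].
  by rewrite -delta_psi delta_ker // iota_psi.
rewrite -delta_psi; have delta0 : delta' 0 = 0 by rewrite delta_ker ?rmorph0.
have -> : delta' (psi (tnth g l)) = delta' (j 'X_l).
  apply/eqP; rewrite -subr_eq0; apply/eqP.
  have deltaN a : - delta' a = delta' (- a).
    apply/eqP; rewrite -subr_eq0 -opprD oppr_eq0 -deltaD subrr.
    by rewrite delta0.
  rewrite deltaN -deltaD delta_ker // rmorphB iota_psi iotaj /iota /=.
  by rewrite comp_mpolyXU (tnth_nth 0) subrr.
by rewrite deltaj /delta mderivXU eq_sym rmorph_nat.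
Qed.

(** * Tangent and normal spaces *)

Section LinearAlgebra.
Variable K : fieldType.

Lemma col_mx_row_free k n (A : 'M[K]_(k, n)) (u : 'rV[K]_n) :
  row_free A -> ~~ (u <= A)%MS -> row_free (col_mx u A).
Proof.
move=> freeA nuA; rewrite /row_free eqn_leq rank_leq_row /= -addsmxE add1n.
rewrite -{1}(eqP freeA); apply: rank_ltmx.
by rewrite ltmxE addsmxSr addsmx_sub submx_refl andbT.
Qed.

Lemma maximal_row_free n (G : 'rV[K]_n -> Prop) :
  exists k (A : 'M[K]_(k, n)), [/\ row_free A, forall i, G (row i A) &
    forall u, G u -> (u <= A)%MS].
Proof.
pose P k := `[< exists A : 'M[K]_(k, n), row_free A /\ forall i, G (row i A) >].
have exP : exists k, P k.
  exists 0%N; apply/asboolP; exists 0; split; last by case.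
  by rewrite /row_free mxrank0.
have ubP k : P k -> (k <= n)%N.
  by move=> /asboolP[A [/eqP rA _]]; rewrite -rA rank_leq_col.
case: (ex_maxnP exP ubP) => k /asboolP[A [freeA GA]] maxk.
exists k, A; split=> // u Gu; apply/negPn/negP => nuA.
suff : P (1 + k)%N by move=> /maxk; rewrite add1n ltnn.
apply/asboolP; exists (col_mx u A); split.
  exact: col_mx_row_free.
move=> i; case: (splitP i) => j ij.
  rewrite (_ : row i _ = u) //; apply/rowP => l.
  have -> : i = lshift k j by apply: val_inj.
  by rewrite !mxE (unsplitK (inl j)) ord1.
rewrite (_ : row i _ = row j A) //; apply/rowP => l.
have -> : i = rshift 1 j by apply: val_inj.
by rewrite !mxE (unsplitK (inr j)).
Qed.

Lemma annihilator_dim k n (A : 'M[K]_(k, n)) : row_free A ->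
  exists V : {vspace 'rV[K]_n}, [set v | v *m A^T = 0] = [set v | v \in V] /\
    (k + \dim V)%N = n.
Proof.
move=> /row_freeP[B AB].
exists (lker (linfun (mulmxr A^T : 'rV[K]_n -> 'rV[K]_k))); split.
  by apply/seteqP; split=> v /=; rewrite memv_ker lfunE /= => /eqP.
set f := linfun _; rewrite -[lker f]capfv.
have dimf : \dim (f @: fullv) = k.
  rewrite (_ : (f @: fullv = fullv)%VS) ?dimvf /dim /= ?mul1n //.
  apply/vspaceP => w; rewrite memvf; apply/memv_imgP.
  exists (w *m B^T); rewrite ?memvf // lfunE /= -mulmxA -trmx_mul AB trmx1.
  by rewrite mulmx1.
by have := limg_ker_dim f fullv; rewrite dimf dimvf /dim /= mul1n addnC.
Qed.

Lemma submx_of_annihilator k n (A : 'M[K]_(k, n)) (u : 'rV[K]_n) :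
  (forall v : 'rV[K]_n, v *m A^T = 0 -> u *m v^T = 0) -> (u <= A)%MS.
Proof.
move=> uA; rewrite submxE; apply/eqP/rowP => j.
have := uA (col j (cokermx A))^T.
rewrite -trmx_mul colE mulmxA mulmx_coker mul0mx trmx0 => /(_ erefl).
by rewrite trmxK mulmxA -colE => /matrixP/(_ 0 0); rewrite !mxE.
Qed.

Lemma row_free_minor k n (A : 'M[K]_(k, n)) :
  row_free A -> exists f : 'I_k -> 'I_n, \det (colsub f A) != 0.
Proof.
move=> freeA; have fullA : row_full A^T by rewrite /row_full mxrank_tr.
exists (fullrankfun fullA); rewrite -unitfE -unitmxE.
by rewrite -unitmx_tr trmx_mxsub fullrowsub_unit.
Qed.

Lemma minor_row_free k n (A : 'M[K]_(k, n)) (f : 'I_k -> 'I_n) :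
  \det (colsub f A) != 0 -> row_free A.
Proof.
rewrite -unitfE -unitmxE -row_free_unit => /eqP frk.
rewrite /row_free eqn_leq rank_leq_row /= -{1}frk.
rewrite (_ : colsub f A = A *m colsub f 1%:M) ?mxrankM_maxl //.
by rewrite mulmx_colsub mulmx1.
Qed.

End LinearAlgebra.

Section Geometry.
Variables (C : numClosedFieldType) (n : nat).
Implicit Types (X : set 'rV[C]_n) (x y u v : 'rV[C]_n) (p q : {mpoly C[n]}).

Definition gradient p x : 'rV[C]_n := \row_k p^`M(k).@[x 0].

Definition jacobian k (p : 'I_k -> {mpoly C[n]}) : 'M[{mpoly C[n]}]_(k, n) :=
  \matrix_(i, j) (p i)^`M(j).

Definition jacobian_at k (p : 'I_k -> {mpoly C[n]}) x : 'M[C]_(k, n) :=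
  map_mx (fun a : {mpoly C[n]} => a.@[x 0]) (jacobian p).

Lemma row_jacobian_at k (p : 'I_k -> {mpoly C[n]}) x i :
  row i (jacobian_at p x) = gradient (p i) x.
Proof. by apply/rowP => j; rewrite !mxE. Qed.

Lemma gradientE p x v :
  \sum_(i < n) p^`M(i).@[x 0] * v 0 i = (gradient p x *m v^T) 0 0.
Proof. by rewrite !mxE; apply: eq_bigr => k _; rewrite !mxE. Qed.

Lemma vanishing_idealD X p q :
  vanishing_ideal X p -> vanishing_ideal X q -> vanishing_ideal X (p + q).
Proof. by move=> Ip Iq x Xx; rewrite mevalD Ip // Iq // addr0. Qed.

Lemma vanishing_idealM X p q : vanishing_ideal X q -> vanishing_ideal X (p * q).
Proof. by move=> Iq x Xx; rewrite mevalM Iq // mulr0. Qed.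

Lemma vanishing_idealZ X c q : vanishing_ideal X q -> vanishing_ideal X (c *: q).
Proof. by rewrite -mul_mpolyC; exact: vanishing_idealM. Qed.

Lemma vanishing_ideal0 X : vanishing_ideal X 0.
Proof. by move=> x _; rewrite meval0. Qed.

Lemma vanishing_ideal_sum X k (p : 'I_k -> {mpoly C[n]}) :
  (forall i, vanishing_ideal X (p i)) -> vanishing_ideal X (\sum_i p i).
Proof.
move=> Ip; apply: (big_ind (vanishing_ideal X)) => //.
  exact: vanishing_ideal0.
exact: vanishing_idealD.
Qed.

Lemma gradient_basis X x : exists k (p : 'I_k -> {mpoly C[n]}),
  [/\ forall i, vanishing_ideal X (p i), row_free (jacobian_at p x) &
      forall q, vanishing_ideal X q -> (gradient q x <= jacobian_at p x)%MS].
Proof.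
pose G (u : 'rV[C]_n) := exists q, vanishing_ideal X q /\ u = gradient q x.
have [k [A [freeA GA maxA]]] := maximal_row_free G.
have [p pE] := choice GA; exists k, p.
have -> : jacobian_at p x = A.
  by apply/row_matrixP => i; rewrite row_jacobian_at; case: (pE i).
by split=> // [i|q Iq]; [case: (pE i) | apply: maxA; exists q].
Qed.

Lemma tangent_spaceE X x k (p : 'I_k -> {mpoly C[n]}) :
  (forall i, vanishing_ideal X (p i)) ->
  (forall q, vanishing_ideal X q -> (gradient q x <= jacobian_at p x)%MS) ->
  tangent_space X x = [set v | v *m (jacobian_at p x)^T = 0].
Proof.
move=> Ip maxp; apply/seteqP; split=> v /= Tv.
  apply/rowP => i; rewrite mxE [RHS]mxE -[RHS](Tv (p i)) //.
  by apply: eq_bigr => j _; rewrite !mxE mulrC.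
move=> q Iq; rewrite gradientE; have /submxP[w ->] := maxp q Iq.
by rewrite -mulmxA -[_ *m v^T]trmxK trmx_mul trmxK Tv trmx0 mulmx0 mxE.
Qed.

Lemma tangent_space_dim X x (V : {vspace 'rV[C]_n}) k (p : 'I_k -> {mpoly C[n]}) :
  (forall i, vanishing_ideal X (p i)) -> row_free (jacobian_at p x) ->
  (forall q, vanishing_ideal X q -> (gradient q x <= jacobian_at p x)%MS) ->
  tangent_space X x = [set v | v \in V] -> (k + \dim V)%N = n.
Proof.
move=> Ip freep maxp TV; have [W [EW dimW]] := annihilator_dim freep.
suff -> : V = W by [].
apply/vspaceP => v.
have := congr1 (fun S : set _ => S v) (etrans (esym TV) (etrans
   (tangent_spaceE Ip maxp) EW)).
by rewrite /= => E; apply/idP/idP; rewrite E.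
Qed.

Lemma tangent_vspace X x : exists V : {vspace 'rV[C]_n},
  tangent_space X x = [set v | v \in V].
Proof.
have [k [p [Ip freep maxp]]] := gradient_basis X x.
have [V [EV _]] := annihilator_dim freep.
by exists V; rewrite (tangent_spaceE Ip maxp).
Qed.

Lemma orthogonal_to_tangent X x u :
  orthogonal_to u (tangent_space X x) <->
  exists q, vanishing_ideal X q /\ u = gradient q x.
Proof.
split=> [orth|[q [Iq ->]] v Tv]; last first.
  by rewrite -[RHS](Tv q Iq); apply: eq_bigr => k _; rewrite mxE.
have [k [p [Ip _ maxp]]] := gradient_basis X x.
have /submxP[w uE] : (u <= jacobian_at p x)%MS.
  apply: submx_of_annihilator => v Av; apply/matrixP => i j.
  rewrite !ord1 !mxE -[RHS](orth v).
    by apply: eq_bigr => l _; rewrite !mxE.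
  by rewrite (tangent_spaceE Ip maxp).
exists (\sum_i w 0 i *: p i); split.
  by apply: vanishing_ideal_sum => i; apply: vanishing_idealZ.
rewrite uE; apply/rowP => j; rewrite !mxE.
rewrite (big_morph _ (mderivD j) (mderiv0 _ j)) raddf_sum.
by apply: eq_bigr => i _; rewrite /= !mxE mderivZ mevalZ.
Qed.

Lemma vanishing_ideal_prime X p q : irreducible_variety X ->
  vanishing_ideal X (p * q) -> vanishing_ideal X p \/ vanishing_ideal X q.
Proof.
move=> [_ _ irr] Ipq.
pose Z (a : {mpoly C[n]}) : set 'rV[C]_n := zero_locus [set a].
have Zclosed a : zariski_closed (Z a) by exists [set a].
have ZP a : X `<=` Z a -> vanishing_ideal X a.
  by move=> XZ x Xx; apply: (XZ x Xx).
case: (irr (Z p) (Z q)) => // [x Xx|/ZP|/ZP]; [|by left|by right].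
have := Ipq x Xx; rewrite mevalM => /eqP; rewrite mulf_eq0.
by case/orP => /eqP h; [left|right] => _ ->.
Qed.

End Geometry.

Lemma vanishing_ideal_field (C : fieldType) N (S : set 'rV[C]_N) : S !=set0 ->
  (forall p q, vanishing_ideal S (p * q) ->
     vanishing_ideal S p \/ vanishing_ideal S q) ->
  exists (L : fieldType) (phi : {rmorphism {mpoly C[N]} -> L}),
    forall p, phi p = 0 <-> vanishing_ideal S p.
Proof.
move=> [s0 Ss0] prime; apply: prime_ideal_field => //.
- by move=> s _; rewrite meval0.
- by move=> /(_ s0 Ss0); rewrite meval1 => /eqP; rewrite oner_eq0.
by move=> a p q Ip Iq s Ss; rewrite mevalD mevalM Ip // Iq // mulr0 addr0.
Qed.

Lemma rmorph_char0 (C : numFieldType) N (L : fieldType)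
  (phi : {rmorphism {mpoly C[N]} -> L}) k : k.+1%:R != 0 :> L.
Proof.
apply/eqP => k0; have /eqP := oner_neq0 L; apply.
rewrite -(rmorph1 phi) -mpolyC1 -(@mulVf C k.+1%:R) ?pnatr_eq0 //.
by rewrite mpolyCM rmorphM mpolyC_nat rmorph_nat k0 mulr0.
Qed.

Section GenericRank.
Variables (C : numClosedFieldType) (N : nat) (S : set 'rV[C]_N).
Variables (L : fieldType) (phi : {rmorphism {mpoly C[N]} -> L}).
Hypothesis phi_ker : forall p, phi p = 0 <-> vanishing_ideal S p.

Lemma generic_row_free k m (B : 'M[{mpoly C[N]}]_(k, m)) :
  row_free (map_mx phi B) <->
  exists2 s, S s & row_free (map_mx (fun a : {mpoly C[N]} => a.@[s 0]) B).
Proof.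
have detE (f : 'I_k -> 'I_m) s : \det (colsub f
    (map_mx (fun a : {mpoly C[N]} => a.@[s 0]) B)) = (\det (colsub f B)).@[s 0].
  by rewrite -map_mxsub -det_map_mx.
split=> [/row_free_minor[f]|[s Ss /row_free_minor[f]]].
  rewrite -map_mxsub det_map_mx => /eqP/phi_ker nI.
  have [s [Ss ns]] : exists s, S s /\ (\det (colsub f B)).@[s 0] <> 0.
    apply: contrapT => nex; apply: nI => s Ss; apply: contrapT => ns.
    by apply: nex; exists s.
  by exists s => //; apply: (@minor_row_free _ _ _ _ f); rewrite detE; apply/eqP.
rewrite detE => ns; apply: (@minor_row_free _ _ _ _ f).
rewrite -map_mxsub det_map_mx; apply/eqP => /phi_ker/(_ s Ss)/eqP.
by rewrite (negbTE ns).
Qed.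

End GenericRank.

Section NormalPairs.
Variables (C : numClosedFieldType) (n : nat) (X : set 'rV[C]_n).
Hypothesis X_irr : irreducible_variety X.
Implicit Types (x y u v : 'rV[C]_n) (p q : {mpoly C[n]}).

(* The derivations dual to the independent family [g] are [d] independent vectors
   annihilated by the Jacobian at the generic point. *)
Lemma jacobian_rank_bound d (g : d.-tuple {mpoly C[n]}) k
    (p : 'I_k -> {mpoly C[n]}) x :
  alg_independent_on X g -> X x -> (forall i, vanishing_ideal X (p i)) ->
  row_free (jacobian_at p x) -> (k + d <= n)%N.
Proof.
move=> indep Xx Ip freep; have [_ X0 _] := X_irr.
have [L [phi phi_ker]] := vanishing_ideal_field X0
  (fun p q => vanishing_ideal_prime X_irr (p := p) (q := q)).
have phi_indep P : phi (P \mPo g) = 0 -> P = 0 by move=> /phi_ker/indep.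
have /choice[v vP] := mpoly_derivation (rmorph_char0 phi) phi_indep.
pose P := map_mx phi (jacobian p).
pose W : 'M[L]_(d, n) := \matrix_(i, j) v i j.
have freeP : \rank P = k.
  by apply/eqP/(generic_row_free phi_ker); exists x.
have freeW : row_free W.
  apply/row_freeP; exists (\matrix_(k, j) phi (tnth g j)^`M(k)).
  apply/matrixP => i j; have [_ /(_ j)] := vP i; rewrite !mxE => <-.
  by apply: eq_bigr => l _; rewrite !mxE mulrC.
rewrite -freeP -(eqP freeW) -(mxrank_tr W); apply: mulmx0_rank_max.
apply/matrixP => i j; rewrite !mxE; have [vI _] := vP j.
rewrite -[RHS](vI (p i)); last exact/phi_ker.
by apply: eq_bigr => l _; rewrite !mxE.
Qed.

Lemma tangent_dim_ge d x (V : {vspace 'rV[C]_n}) : has_dimension X d -> X x ->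
  tangent_space X x = [set v | v \in V] -> (d <= \dim V)%N.
Proof.
move=> [[g indep] _] Xx TV; have [k [p [Ip freep maxp]]] := gradient_basis X x.
have := jacobian_rank_bound indep Xx Ip freep.
by rewrite -[X in (_ <= X)%N](tangent_space_dim Ip freep maxp TV) leq_add2l.
Qed.

Lemma regular_locus_dim x x' (V V' : {vspace 'rV[C]_n}) :
  X x -> X x' -> has_dimension X (\dim V) -> has_dimension X (\dim V') ->
  tangent_space X x = [set v | v \in V] ->
  tangent_space X x' = [set v | v \in V'] -> \dim V = \dim V'.
Proof.
move=> Xx Xx' dV dV' TV TV'; apply/eqP; rewrite eqn_leq.
by rewrite (tangent_dim_ge dV Xx' TV') (tangent_dim_ge dV' Xx TV).
Qed.

Lemma regular_locus_open x : regular_locus X x ->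
  exists2 M : {mpoly C[n]}, M.@[x 0] != 0 &
    forall x', X x' -> M.@[x' 0] != 0 -> regular_locus X x'.
Proof.
move=> [Xx [V [TV dV]]]; have [k [p [Ip freep maxp]]] := gradient_basis X x.
have [f nf] := row_free_minor freep.
have detE x' : \det (colsub f (jacobian_at p x')) =
    (\det (colsub f (jacobian p))).@[x' 0].
  by rewrite /jacobian_at -map_mxsub -det_map_mx.
exists (\det (colsub f (jacobian p))); rewrite -?detE // => x' Xx'.
rewrite -detE => /minor_row_free freep'; split=> //.
have [V' TV'] := tangent_vspace X x'; exists V'; split=> //.
have [k' [p' [Ip' freep'' maxp']]] := gradient_basis X x'.
have le_kk' : (k <= k')%N.
  rewrite -(eqP freep') -(eqP freep''); apply: mxrankS; apply/row_subP => i.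
  by rewrite row_jacobian_at; exact: maxp'.
have dimV := tangent_space_dim Ip freep maxp TV.
have dimV' := tangent_space_dim Ip' freep'' maxp' TV'.
suff -> : \dim V' = \dim V by [].
apply/eqP; rewrite eqn_leq (tangent_dim_ge dV Xx' TV') andbT.
have : (k + \dim V <= k' + \dim V)%N by rewrite leq_add2r.
by rewrite dimV -[X in (X <= _)%N]dimV' leq_add2l.
Qed.

Definition normal_pairs : set 'rV[C]_(n + n) :=
  [set row_mx xy.1 xy.2 | xy in
     [set xy : 'rV[C]_n * 'rV[C]_n |
        regular_locus X xy.1 /\
        orthogonal_to (xy.1 - xy.2) (tangent_space X xy.1)]].

Lemma normal_pairsP z : normal_pairs z <-> exists x q,
  [/\ regular_locus X x, vanishing_ideal X q & z = row_mx x (x - gradient q x)].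
Proof.
split=> [[[x y] /= [Rx /orthogonal_to_tangent[q [Iq xyE]]] <-]|].
  by exists x, q; split=> //; rewrite -xyE subKr.
move=> [x [q [Rx Iq ->]]]; exists (x, x - gradient q x) => //=; split=> //.
by apply/orthogonal_to_tangent; exists q; split=> //; rewrite subKr.
Qed.

Definition on_normal q : {mpoly C[n + n]} -> {mpoly C[n]} :=
  mmap (@mpolyC n C)
    (fun k => match split k with inl i => 'X_i | inr i => 'X_i - q^`M(i) end).
HB.instance Definition _ q := GRing.RMorphism.on (on_normal q).

Lemma meval_on_normal q P x :
  (on_normal q P).@[x 0] = P.@[row_mx x (x - gradient q x) 0].
Proof.
apply: (mpoly_rmorph_ext (f := (meval (x 0) \o on_normal q)%FUN)
  (g := meval (row_mx x (x - gradient q x) 0))) => [c|k] /=.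
  by rewrite /on_normal mmapC !mevalC.
rewrite /on_normal mmapX mmap1U mevalXU mxE.
by case: split => i; rewrite ?mevalB !mevalXU ?mxE.
Qed.

(* Two points of the normal bundle lie over a common line of normal fields:
   [y = x - grad (s q1 + (1 - s) q2) x], with [s = 1] and [s = 0]. *)
Lemma normal_pairs_prime P Q : vanishing_ideal normal_pairs (P * Q) ->
  vanishing_ideal normal_pairs P \/ vanishing_ideal normal_pairs Q.
Proof.
move=> IPQ; apply: contrapT => /not_orP[nP nQ].
have nonzero (P' : {mpoly C[n + n]}) : ~ vanishing_ideal normal_pairs P' ->
    exists x q, [/\ regular_locus X x, vanishing_ideal X q &
      (on_normal q P').@[x 0] != 0].
  move=> nP'; apply: contrapT => nex; apply: nP' => z /normal_pairsP.
  move=> [x [q [Rx Iq ->]]]; apply/eqP/negPn/negP => nz; apply: nex.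
  by exists x, q; rewrite meval_on_normal.
have [x1 [q1 [R1 Iq1 n1]]] := nonzero _ nP.
have [x2 [q2 [R2 Iq2 n2]]] := nonzero _ nQ.
pose q s := s *: q1 + (1 - s) *: q2.
pose line x (k : 'I_(n + n)) : {poly C} := match split k with
  | inl i => (x 0 i)%:P
  | inr i => (x 0 i)%:P - ((gradient q1 x 0 i)%:P * 'X +
                           (gradient q2 x 0 i)%:P * (1 - 'X)) end.
have lineE x s P' : (on_normal (q s) P').@[x 0] = (mmap polyC (line x) P').[s].
  rewrite meval_on_normal.
  apply: (mpoly_rmorph_ext (f := meval _)
    (g := (horner_eval s \o mmap polyC (line x))%FUN)) => [c|k] /=.
    by rewrite mmapC mevalC /horner_eval hornerC.
  rewrite mmapX mmap1U mevalXU /line mxE /horner_eval; case: split => i.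
    by rewrite hornerC.
  rewrite !hornerE !mxE mderivD !mderivZ mevalD !mevalZ.
  by ring.
have qE1 : q 1 = q1 by rewrite /q subrr scale0r addr0 scale1r.
have qE0 : q 0 = q2 by rewrite /q subr0 scale0r add0r scale1r.
have [s] : exists s, ~~ root (mmap polyC (line x1) P * mmap polyC (line x2) Q) s.
  apply/closed_nonrootP; rewrite mulf_neq0 //; apply/eqP => H.
    by move: n1; rewrite -qE1 lineE H horner0 eqxx.
  by move: n2; rewrite -qE0 lineE H horner0 eqxx.
rewrite rootM negb_or /root -!lineE => /andP[ns1 ns2].
have Iqs : vanishing_ideal X (q s).
  by apply: vanishing_idealD; apply: vanishing_idealZ.
have [M nM Mreg] := regular_locus_open R1.
have : vanishing_ideal X (M * (on_normal (q s) P * on_normal (q s) Q)).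
  move=> x Xx; rewrite mevalM; have [->|nMx] := eqVneq M.@[x 0] 0.
    by rewrite mul0r.
  rewrite -[on_normal _ P * _]rmorphM meval_on_normal IPQ ?mulr0 //; apply/normal_pairsP.
  by exists x, (q s); split=> //; apply: Mreg.
have [X1 X2] : X x1 /\ X x2 by case: R1 R2 => ? _ [].
case/(vanishing_ideal_prime X_irr) => [/(_ _ X1)|].
  by move/eqP; rewrite (negbTE nM).
case/(vanishing_ideal_prime X_irr) => [/(_ _ X1)|/(_ _ X2)] /eqP.
  by rewrite (negbTE ns1).
by rewrite (negbTE ns2).
Qed.

End NormalPairs.

Section DerivationOnPolynomials.
Variables (C L : fieldType) (N : nat) (phi : {rmorphism {mpoly C[N]} -> L}).
Variable v : 'I_N -> L.

Definition mpoly_der (a : {mpoly C[N]}) : L := \sum_k phi a^`M(k) * v k.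

Lemma mpoly_derD : {morph mpoly_der : a b / a + b}.
Proof.
move=> a b; rewrite /mpoly_der -big_split; apply: eq_bigr => k _.
by rewrite mderivD rmorphD mulrDl.
Qed.

Lemma mpoly_derM a b :
  mpoly_der (a * b) = phi a * mpoly_der b + mpoly_der a * phi b.
Proof.
rewrite /mpoly_der mulr_sumr mulr_suml -big_split; apply: eq_bigr => k _ /=.
by rewrite mderivM rmorphD !rmorphM; ring.
Qed.

Lemma mpoly_derC c : mpoly_der c%:MP = 0.
Proof. by apply: big1 => k _; rewrite mderivC rmorph0 mul0r. Qed.

Lemma mpoly_derX k : mpoly_der 'X_k = v k.
Proof.
rewrite /mpoly_der (bigD1 k) //= big1 => [|l lk]; rewrite mderivXU.
  by rewrite eqxx rmorph1 mul1r addr0.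
by rewrite eq_sym (negbTE lk) rmorph0 mul0r.
Qed.

Lemma mpoly_derN a : mpoly_der (- a) = - mpoly_der a.
Proof.
apply/eqP; rewrite -subr_eq0 opprK -mpoly_derD addNr -mpolyC0.
by rewrite mpoly_derC.
Qed.

Lemma mpoly_der_chain n (f : {rmorphism {mpoly C[n]} -> {mpoly C[N]}}) p :
  (forall c, f c%:MP = c%:MP) ->
  mpoly_der (f p) = \sum_i phi (f p^`M(i)) * mpoly_der (f 'X_i).
Proof.
move=> fC; apply: chain_rule => [|a b|c].
- exact: mpoly_derD.
- exact: mpoly_derM.
by rewrite fC mpoly_derC.
Qed.

End DerivationOnPolynomials.

Section FirstVariables.
Variables (C : fieldType) (n : nat).

Definition in_fst : {mpoly C[n]} -> {mpoly C[n + n]} :=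
  mmap (@mpolyC (n + n) C) (fun i => 'X_(lshift n i)).
HB.instance Definition _ := GRing.RMorphism.on in_fst.

Definition in_snd : {mpoly C[n]} -> {mpoly C[n + n]} :=
  mmap (@mpolyC (n + n) C) (fun i => 'X_(rshift n i)).
HB.instance Definition _ := GRing.RMorphism.on in_snd.

Lemma in_fstC c : in_fst c%:MP = c%:MP. Proof. exact: mmapC. Qed.

Lemma in_sndC c : in_snd c%:MP = c%:MP. Proof. exact: mmapC. Qed.

Lemma in_fstX i : in_fst 'X_i = 'X_(lshift n i).
Proof. by rewrite /in_fst mmapX mmap1U. Qed.

Lemma in_sndX i : in_snd 'X_i = 'X_(rshift n i).
Proof. by rewrite /in_snd mmapX mmap1U. Qed.

Lemma meval_in_fst p (x y : 'rV[C]_n) : (in_fst p).@[row_mx x y 0] = p.@[x 0].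
Proof.
apply: (mpoly_rmorph_ext (f := (meval (row_mx x y 0) \o in_fst)%FUN)
  (g := meval (x 0))) => [c|k] /=; first by rewrite in_fstC !mevalC.
by rewrite in_fstX !mevalXU row_mxEl.
Qed.

Lemma meval_in_snd p (x y : 'rV[C]_n) : (in_snd p).@[row_mx x y 0] = p.@[y 0].
Proof.
apply: (mpoly_rmorph_ext (f := (meval (row_mx x y 0) \o in_snd)%FUN)
  (g := meval (y 0))) => [c|k] /=; first by rewrite in_sndC !mevalC.
by rewrite in_sndX !mevalXU row_mxEr.
Qed.

End FirstVariables.

Section GenericNormal.
Variables (C : numClosedFieldType) (n : nat) (X : set 'rV[C]_n).
Hypothesis X_irr : irreducible_variety X.
Variables (L : fieldType) (phi : {rmorphism {mpoly C[n + n]} -> L}).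
Hypothesis phi_ker : forall p, phi p = 0 <-> vanishing_ideal (normal_pairs X) p.
Hypothesis normal_pairs0 : normal_pairs X !=set0.

Lemma generic_normal_orthogonal (v : 'I_(n + n) -> L) :
  (forall p, phi p = 0 -> mpoly_der phi v p = 0) ->
  \sum_i (phi 'X_(lshift n i) - phi 'X_(rshift n i)) * v (lshift n i) = 0.
Proof.
move=> vI; have [z0 Sz0] := normal_pairs0.
have /normal_pairsP[x0 [q0 [R0 Iq0 z0E]]] := Sz0.
have [X0 [V [TV dV]]] := R0; have [k [p [Ip freep maxp]]] := gradient_basis X x0.
have dimV := tangent_space_dim Ip freep maxp TV.
pose J : 'M[{mpoly C[n + n]}]_(k, n) := map_mx (@in_fst C n) (jacobian p).
pose u : 'rV[{mpoly C[n + n]}]_n := \row_j ('X_(lshift n j) - 'X_(rshift n j)).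
have Jat x y : map_mx (fun a : {mpoly C[n + n]} => a.@[row_mx x y 0]) J =
    jacobian_at p x.
  by apply/matrixP => i j; rewrite !mxE meval_in_fst.
have freeJ : row_free (map_mx phi J).
  by apply/(generic_row_free phi_ker); exists z0 => //; rewrite z0E Jat.
have : ~~ row_free (col_mx (map_mx phi u) (map_mx phi J)).
  rewrite -map_col_mx; apply/negP => /(generic_row_free phi_ker)[z].
  move=> /normal_pairsP[x [q [[Xx [V' [TV' dV']]] Iq ->]]].
  rewrite map_col_mx Jat.
  have [k' [p' [Ip' freep' maxp']]] := gradient_basis X x.
  have dimV' := tangent_space_dim Ip' freep' maxp' TV'.
  have kk' : k = k'.
    apply/eqP; rewrite -(eqn_add2r (\dim V)) dimV.
    by rewrite (regular_locus_dim X_irr X0 Xx dV dV' TV TV') dimV'.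
  rewrite /row_free => /eqP rk.
  suff : (1 + k <= k)%N by rewrite add1n ltnn.
  rewrite -{1}rk {4}kk' -(eqP freep'); apply: mxrankS.
  rewrite col_mx_sub; apply/andP; split; last first.
    by apply/row_subP => i; rewrite row_jacobian_at maxp'.
  set w := map_mx _ u; suff -> : w = gradient q x by apply: maxp'.
  apply/rowP => j; rewrite !mxE mevalB !mevalXU row_mxEl row_mxEr !mxE.
  by rewrite subKr.
move=> /(contra (col_mx_row_free freeJ)); rewrite negbK => /submxP[w uE].
transitivity ((map_mx phi u *m (\col_i v (lshift n i))) 0 0).
  by rewrite mxE; apply: eq_bigr => i _; rewrite !mxE rmorphB.
rewrite uE -mulmxA (_ : _ *m \col_i _ = 0) ?mulmx0 ?mxE //.
apply/matrixP => i l; rewrite [RHS]mxE -(vI (in_fst (p i))); last first.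
  apply/phi_ker => z /normal_pairsP[x [q [[Xx _] _ ->]]].
  by rewrite meval_in_fst Ip.
rewrite mpoly_der_chain; last exact: in_fstC.
by rewrite mxE; apply: eq_bigr => j _; rewrite !mxE /= in_fstX mpoly_derX.
Qed.

End GenericNormal.

(** * Polynomial relations of minimal degree *)

Section MinimalRelation.
Variables (A : idomainType) (L : fieldType) (Phi : {rmorphism {poly A} -> L}).
Hypothesis L_char0 : forall k, k.+1%:R != 0 :> L.
Hypothesis Phi_inj : forall a : A, Phi a%:P = 0 -> a = 0.

Definition minimal_relation (G : {poly A}) : Prop :=
  [/\ G != 0, Phi G = 0 &
      forall h, h != 0 -> Phi h = 0 -> (size G <= size h)%N].

Lemma ex_minimal_relation h : h != 0 -> Phi h = 0 -> exists G, minimal_relation G.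
Proof.
move=> h0 Phi_h.
pose P s := `[< exists h, [/\ h != 0, Phi h = 0 & size h = s] >].
have exP : exists s, P s by exists (size h); apply/asboolP; exists h.
case: (ex_minnP exP) => s /asboolP[G [G0 PhiG sG]] mins; exists G; split=> //.
by move=> k k0 Phi_k; rewrite sG; apply: mins; apply/asboolP; exists k.
Qed.

Variable G : {poly A}.
Hypothesis minG : minimal_relation G.

Lemma minimal_relation_dvd h : Phi h = 0 ->
  exists k q, lead_coef G ^+ k *: h = q * G.
Proof.
have [G0 PhiG min] := minG; move=> Phi_h.
exists (scalp h G), (h %/ G); rewrite Pdiv.Idomain.divp_eq.
suff -> : h %% G = 0 by rewrite addr0.
apply/eqP/negPn/negP => r0; have := Pdiv.Idomain.ltn_modpN0 h G0.
rewrite ltnNge min //.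
have -> : h %% G = lead_coef G ^+ scalp h G *: h - h %/ G * G.
  by rewrite Pdiv.Idomain.divp_eq addrC addKr.
by rewrite -mul_polyC rmorphB !rmorphM Phi_h PhiG !mulr0 subrr.
Qed.

Lemma minimal_relation_size : (1 < size G)%N.
Proof.
have [G0 PhiG _] := minG; rewrite ltnNge; apply/negP => /size1_polyC GE.
by move: G0 PhiG; rewrite GE polyC_eq0 => /negP c0 /Phi_inj/eqP.
Qed.

Lemma minimal_relation_deriv : Phi G^`() != 0.
Proof.
have [G0 _ min] := minG; apply/eqP => PhiG'.
have [G'0|/min/(_ PhiG')] := eqVneq G^`() 0; last first.
  by rewrite leqNgt lt_size_deriv.
suff : (size G <= 1)%N by rewrite leqNgt minimal_relation_size.
apply/leq_sizeP => -[//|j] _.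
have := congr1 (fun q : {poly A} => q`_j) G'0.
rewrite coef_deriv coef0 -mulr_natl => /eqP; rewrite mulf_eq0.
case/orP => /eqP // j0; have /eqP := L_char0 j; case.
by rewrite -(rmorph_nat Phi) -[_%:R]polyC_natr j0 rmorph0.
Qed.

Lemma minimal_relation_bezout : exists r U V,
  r != 0 /\ r%:P = U * G + V * G^`().
Proof.
have [G0 PhiG min] := minG.
have [s1|s1] := leqP (size G^`()) 1.
  have G'E := size1_polyC s1; exists (G^`())`_0, 0, 1; rewrite -G'E.
  rewrite mul0r add0r mul1r; split=> //; apply/eqP => c0.
  by have := minimal_relation_deriv; rewrite G'E c0 rmorph0 eqxx.
case: (resultant_in_ideal minimal_relation_size s1) => -[U V] /= _ UV.
exists (resultant G G^`()), U, V; split=> //.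
rewrite resultant_eq0 -leqNgt leqNgt; apply/negP => sD.
set D := gcdp _ _ in sD.
have /Pdiv.Idomain.dvdpP[[c q] /= c0 cG] : D %| G by exact: dvdp_gcdl.
have /Pdiv.Idomain.dvdpP[[c' q'] /= c'0 cG'] : D %| G^`() by exact: dvdp_gcdr.
have PhiC a p : a != 0 -> Phi (a *: p) = 0 -> Phi p = 0.
  rewrite -mul_polyC rmorphM => a0 /eqP; rewrite mulf_eq0 => /orP[|/eqP //].
  by move=> /eqP/Phi_inj aE; rewrite aE eqxx in a0.
have PhiD : Phi D != 0.
  apply/eqP => PhiD; have /eqP := minimal_relation_deriv; apply.
  by apply: (PhiC c') => //; rewrite cG' rmorphM PhiD mulr0.
have : Phi (q * D) = 0 by rewrite -cG -mul_polyC rmorphM PhiG mulr0.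
rewrite rmorphM => /eqP; rewrite mulf_eq0 (negbTE PhiD) orbF => /eqP Phi_q.
have q0 : q != 0.
  apply/eqP => qE; move/eqP: cG; rewrite qE mul0r -mul_polyC mulf_eq0.
  by rewrite polyC_eq0 (negbTE c0) (negbTE G0).
have D0 : D != 0 by rewrite -size_poly_gt0; apply: leq_trans sD.
have := min q q0 Phi_q; rewrite -(size_scale G c0) cG size_mul //.
by move: sD; case: (size D) => [|[|k]] //= _; rewrite !addnS /=; lia.
Qed.

End MinimalRelation.

(* Homogenizing [p] with the common denominator [w]. *)
Lemma clear_denominators (K B : comNzRingType) N (inj : {rmorphism K -> B})
    (w : B) (u : 'I_N -> B) (p : {mpoly K[N]}) :
  exists k b, forall (F : comNzRingType) (alpha : {rmorphism B -> F})
      (f : {rmorphism {mpoly K[N]} -> F}),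
    (forall c, f c%:MP = alpha (inj c)) ->
    (forall i, alpha w * f 'X_i = alpha (u i)) ->
    alpha b = alpha w ^+ k * f p.
Proof.
elim/mpoly_ring_ind: p => [c|i|p q [k [b kb]] [l [a la]]|p q [k [b kb]] [l [a la]]].
- by exists 0%N, (inj c) => F alpha f fC _; rewrite expr0 mul1r fC.
- by exists 1%N, (u i) => F alpha f _ fX; rewrite expr1 fX.
- exists (k + l)%N, (w ^+ l * b + w ^+ k * a) => F alpha f fC fX.
  rewrite !rmorphD !rmorphM !rmorphXn (kb _ _ f) // (la _ _ f) // exprD.
  by ring.
exists (k + l)%N, (b * a) => F alpha f fC fX.
by rewrite !rmorphM (kb _ _ f) // (la _ _ f) // exprD; ring.
Qed.

(** * Polynomials in one distinguished variable *)

Section LastVariable.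
Variables (C : fieldType) (n : nat).
Implicit Types (f : {mpoly C[n + 1]}) (h : {poly {mpoly C[n]}}) (y : 'rV[C]_n).

Definition to_univ : {mpoly C[n + 1]} -> {poly {mpoly C[n]}} :=
  mmap (polyC \o @mpolyC n C)
    (fun k => match split k with inl i => ('X_i)%:P | inr _ => 'X end).
HB.instance Definition _ := GRing.RMorphism.on to_univ.

Definition eval_univ y (e : C) : {poly {mpoly C[n]}} -> C :=
  horner_eval e \o map_poly (meval (y 0)).
HB.instance Definition _ y e := GRing.RMorphism.on (eval_univ y e).

Lemma eval_univC y e a : eval_univ y e a%:P = a.@[y 0].
Proof. by rewrite /eval_univ /= map_polyC /horner_eval hornerC. Qed.

Lemma eval_univX y e : eval_univ y e 'X = e.
Proof. by rewrite /eval_univ /= map_polyX /horner_eval hornerX. Qed.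

Lemma eval_univ_comp_sqr y e h :
  eval_univ y e (h \Po 'X^2) = eval_univ y (e ^+ 2) h.
Proof.
rewrite /eval_univ /= map_comp_poly map_polyXn /horner_eval horner_comp.
by rewrite hornerXn.
Qed.

Lemma to_univC c : to_univ c%:MP = c%:MP%:P.
Proof. exact: mmapC. Qed.

Lemma to_univ_lshift i : to_univ 'X_(lshift 1 i) = ('X_i)%:P.
Proof. by rewrite /to_univ mmapX mmap1U (unsplitK (inl i)). Qed.

Lemma to_univ_rshift i : to_univ 'X_(rshift n i) = 'X.
Proof. by rewrite /to_univ mmapX mmap1U (unsplitK (inr i)). Qed.

Lemma eval_to_univ y e f :
  eval_univ y e (to_univ f) = f.@[row_mx y (const_mx e) 0].
Proof.
apply: (mpoly_rmorph_ext (f := (eval_univ y e \o to_univ)%FUN)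
  (g := meval (row_mx y (const_mx e) 0))) => [c|k] /=.
  by rewrite to_univC eval_univC !mevalC.
rewrite mevalXU; case: (split_ordP k) => i ->.
  by rewrite to_univ_lshift eval_univC mevalXU row_mxEl.
by rewrite to_univ_rshift eval_univX row_mxEr mxE.
Qed.

Definition restrict_mnm (m : 'X_{1..n + 1}) : 'X_{1..n} :=
  [multinom m (lshift 1 i) | i < n].

Lemma to_univE f : to_univ f = \sum_(m <- msupp f)
  (f@_m)%:MP%:P * (('X_[restrict_mnm m])%:P * 'X^(m (eps_index n))).
Proof.
apply: eq_bigr => m _; congr (_ * _).
rewrite /mmap1 big_split_ord big_ord1 (unsplitK (inr ord0)); congr (_ * _).
rewrite mpolyXE_id rmorph_prod; apply: eq_bigr => i _ /=.
by rewrite (unsplitK (inl i)) rmorphXn mnmE.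
Qed.

Lemma coef_to_univ f m :
  ((to_univ f)`_(m (eps_index n)))@_(restrict_mnm m) = f@_m.
Proof.
rewrite [in RHS](mpolyE f) to_univE coef_sum !raddf_sum /=.
apply: eq_bigr => m' _; rewrite mcoeffZ mcoeffX coefCM mcoeffCM; congr (_ * _).
rewrite coefCM coefXn; case: (m' =P m) => [->|ne].
  by rewrite eqxx mulr1 mcoeffX eqxx.
case: eqP => [eps_eq|]; last by rewrite mulr0 mcoeff0.
rewrite mulr1 mcoeffX; case: eqP => // restr_eq; case: ne.
apply/mnmP => k; case: (split_ordP k) => i ->; last by rewrite ord1.
by have := congr1 (fun m0 : 'X_{1..n} => m0 i) restr_eq; rewrite !mnmE.
Qed.

Lemma to_univ_eq0 f : (to_univ f == 0) = (f == 0).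
Proof.
apply/eqP/eqP => [f0|->]; last exact: rmorph0.
by apply/mpolyP => m; rewrite -coef_to_univ f0 coef0 !mcoeff0.
Qed.

Lemma size_to_univ f : f != 0 ->
  size (to_univ f) = (degree_in (eps_index n) f).+1.
Proof.
move=> f0; apply/eqP; rewrite eqn_leq; apply/andP; split.
  apply/leq_sizeP => j lt_j; rewrite to_univE coef_sum big_seq big1 // => m mf.
  rewrite !coefCM coefXn gtn_eqF ?mulr0 //; apply: leq_trans lt_j; rewrite ltnS.
  exact: (leq_bigmax_seq (F := fun m : 'X_{1..n + 1} => m (eps_index n))).
have s_gt0 : (0 < size (to_univ f))%N by rewrite size_poly_gt0 to_univ_eq0.
rewrite -(ltn_predK s_gt0) ltnS; apply/bigmax_leqP_seq => m mf _.
rewrite -ltnS (ltn_predK s_gt0) ltnNge.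
apply: contraL mf => /leq_sizeP/(_ _ (leqnn _)) c0.
by rewrite mcoeff_msupp -coef_to_univ c0 mcoeff0 eqxx.
Qed.

Lemma to_univ_surj h : exists f, to_univ f = h.
Proof.
have lift (a : {mpoly C[n]}) : exists f, to_univ f = a%:P.
  elim/mpoly_ring_ind: a => [c|i|p q [f fE] [g gE]|p q [f fE] [g gE]].
  - by exists c%:MP; rewrite to_univC.
  - by exists 'X_(lshift 1 i); rewrite to_univ_lshift.
  - by exists (f + g); rewrite rmorphD /= fE gE polyCD.
  by exists (f * g); rewrite rmorphM /= fE gE polyCM.
elim/poly_ind: h => [|h a [f fE]]; first by exists 0; rewrite rmorph0.
have [g gE] := lift a; exists (f * 'X_(rshift n ord0) + g).
by rewrite rmorphD rmorphM /= fE gE to_univ_rshift.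
Qed.

End LastVariable.

Lemma mpoly_nonzero_point (C : numClosedFieldType) n (p : {mpoly C[n]}) :
  p != 0 -> exists x : 'rV[C]_n, p.@[x 0] != 0.
Proof.
elim: n p => [|n IHn] p p0.
  exists 0; move: p0; rewrite [p]nvar0_mpolyC mevalC.
  by apply: contra => /eqP->; rewrite mpolyC0.
move: p p0; rewrite -addn1 => p p0.
have h0 : lead_coef (to_univ p) != 0 by rewrite lead_coef_eq0 to_univ_eq0.
have [y ny] := IHn _ h0.
have : map_poly (meval (y 0)) (to_univ p) != 0.
  apply/eqP => /polyP/(_ (size (to_univ p)).-1); rewrite coef_map coef0 /=.
  by move/eqP; rewrite (negbTE ny).
move=> /closed_nonrootP[e ne]; exists (row_mx y (const_mx e)).
by rewrite -eval_to_univ.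
Qed.

Lemma nonconstant_mpoly_zero (C : numClosedFieldType) n (g : {mpoly C[n]}) :
  (1 < msize g)%N -> exists x : 'rV[C]_n, g.@[x 0] = 0.
Proof.
move=> g_gt1; apply: contrapT => nz.
have gconst (b : 'rV[C]_n) : g.@[b 0] = g.@[(0 : 'rV[C]_n) 0].
  pose q : {poly C} := mmap polyC (fun k => (b 0 k)%:P * 'X) g.
  have qE s : q.[s] = g.@[(s *: b) 0].
    apply: (mpoly_rmorph_ext
      (f := (horner_eval s \o mmap polyC (fun k => (b 0 k)%:P * 'X))%FUN)
      (g := meval ((s *: b) 0))) => [c|k] /=.
      by rewrite mmapC mevalC /horner_eval hornerC.
    by rewrite mmapX mmap1U mevalXU /horner_eval !hornerE mxE mulrC.
  have : size q == 1%N.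
    apply: contraT => /closed_rootP[s /rootP]; rewrite qE => gs.
    by case: nz; exists (s *: b).
  move=> /eqP s1; have sq : (size q <= 1)%N by rewrite s1.
  by rewrite -(scale1r b) -(scale0r b) -!qE (size1_polyC sq) !hornerC.
have [/eqP|/mpoly_nonzero_point[x]] := eqVneq (g - (g.@[(0 : 'rV[C]_n) 0])%:MP) 0.
  rewrite subr_eq0 => /eqP gE; move: g_gt1; rewrite gE msizeC.
  by case: (_ != 0).
by rewrite mevalB mevalC gconst subrr eqxx.
Qed.

(** * The offset family *)

Section ZariskiClosure.
Variables (C : fieldType) (N : nat).
Implicit Types S : set 'rV[C]_N.

Lemma subset_zariski_closure S : S `<=` zariski_closure S.
Proof. by move=> z Sz p; apply. Qed.

Lemma vanishing_ideal_closure S :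
  vanishing_ideal (zariski_closure S) = vanishing_ideal S.
Proof.
apply/seteqP; split=> p Ip z; last by apply.
by move=> /subset_zariski_closure/Ip.
Qed.

End ZariskiClosure.

Section Distance.
Variables (C : fieldType) (n : nat).

Definition sqdist_mpoly : {mpoly C[n + n]} :=
  \sum_(i < n) ('X_(lshift n i) - 'X_(rshift n i)) ^+ 2.

Lemma meval_sqdist (z : 'rV[C]_(n + n)) :
  sqdist_mpoly.@[z 0] = sqdist (lsubmx z) (rsubmx z).
Proof.
rewrite raddf_sum; apply: eq_bigr => i _ /=.
by rewrite rmorphXn /= mevalB !mevalXU !mxE.
Qed.

Definition at_dist : {poly {mpoly C[n]}} -> {mpoly C[n + n]} :=
  horner_eval sqdist_mpoly \o map_poly (@in_snd C n).
HB.instance Definition _ := GRing.RMorphism.on at_dist.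

Lemma at_distC a : at_dist a%:P = in_snd a.
Proof. by rewrite /at_dist /= map_polyC /horner_eval hornerC. Qed.

Lemma at_distX : at_dist 'X = sqdist_mpoly.
Proof. by rewrite /at_dist /= map_polyX /horner_eval hornerX. Qed.

Lemma at_distMXaddC h a :
  at_dist (h * 'X + a%:P) = at_dist h * sqdist_mpoly + in_snd a.
Proof.
by rewrite [LHS]rmorphD [X in X + _]rmorphM /= at_distX at_distC.
Qed.

Lemma meval_at_dist (z : 'rV[C]_(n + n)) h : (at_dist h).@[z 0] =
  eval_univ (rsubmx z) (sqdist (lsubmx z) (rsubmx z)) h.
Proof.
elim/poly_ind: h => [|h a IHh]; first by rewrite !rmorph0.
rewrite at_distMXaddC mevalD mevalM IHh meval_sqdist rmorphD rmorphM /=.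
by rewrite eval_univX eval_univC -[in (in_snd a).@[_]](hsubmxK z) meval_in_snd.
Qed.

Lemma meval_horner (y : 'rV[C]_n) e h : h.[e%:MP].@[y 0] = eval_univ y e h.
Proof.
elim/poly_ind: h => [|h a IHh]; first by rewrite horner0 !rmorph0.
rewrite hornerMXaddC mevalD mevalM mevalC IHh rmorphD rmorphM /=.
by rewrite eval_univX eval_univC.
Qed.

End Distance.

Lemma chain_rule_univ (A B : comNzRingType) (L : fieldType)
    (phi : {rmorphism B -> L}) (D : B -> L) (delta : A -> A)
    (f : {rmorphism {poly A} -> B}) (h : {poly A}) :
  {morph D : a b / a + b} ->
  (forall a b, D (a * b) = phi a * D b + D a * phi b) ->
  {morph delta : a b / a + b} -> delta 0 = 0 ->
  (forall a, D (f a%:P) = phi (f (delta a)%:P)) ->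
  D (f h) = phi (f (map_poly delta h)) + phi (f h^`()) * D (f 'X).
Proof.
move=> DD DM deltaD delta0 DC; elim/poly_ind: h => [|h a IHh].
  by rewrite deriv0 map_poly0 -polyC0 DC delta0 !rmorph0 mul0r addr0.
have -> : map_poly delta (h * 'X + a%:P) =
    map_poly delta h * 'X + (delta a)%:P.
  apply/polyP => i; rewrite coefD coefMX coefC !coef_map_id0 //.
  rewrite coefD coefMX coefC deltaD.
  by case: i => [|i] /=; rewrite delta0.
rewrite derivMXaddC !rmorphD !rmorphM !DD DM IHh DC.
by ring.
Qed.

Lemma EDdegree_generic (C : numClosedFieldType) n (X : set 'rV[C]_n) m :
  generically [set y0 |
    ([set z | ED_correspondence X z /\ rsubmx z = y0] #= `I_m)%card] ->
  EDdegree X = m.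
Proof.
move=> [g g0 gm]; apply: xget_unique; first by exists g.
move=> m' gen'; have [g' g'0 gm'] : generically _ := gen'.
have [y] := mpoly_nonzero_point (mulf_neq0 g0 g'0).
rewrite mevalM mulf_eq0 negb_or => /andP[gy g'y].
have := gm y gy; have := gm' y g'y => /= cm' cm; apply/card_eq_II.
by apply: card_eq_trans cm; rewrite card_eq_sym.
Qed.

Section OffsetFamily.
Variables (C : numClosedFieldType) (n : nat) (X : set 'rV[C]_n).

Lemma vanishing_ideal_family (f : {mpoly C[n + 1]}) :
  vanishing_ideal (offset_family X) f <->
  forall z e, ED_correspondence X z -> sqdist (lsubmx z) (rsubmx z) = e ^+ 2 ->
    eval_univ (rsubmx z) e (to_univ f) = 0.
Proof.
rewrite vanishing_ideal_closure; split=> [If z e Ez ze|If _ [[y e] /= Oy] <-].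
  rewrite eval_to_univ; apply: If; exists (rsubmx z, e) => //=.
  apply: subset_zariski_closure; exists z => //; split=> //=.
  by rewrite ze subrr.
rewrite -eval_to_univ -meval_horner.
apply: (Oy (to_univ f).[e%:MP]) => _ [z [Ez /eqP ze] <-].
by rewrite meval_horner If //; apply/eqP; rewrite -subr_eq0.
Qed.

Lemma sqdist_not_vanishing :
  generically [set e : 'rV[C]_1 | hypersurface (offset X (e 0 0))] ->
  ~ vanishing_ideal (normal_pairs X) (sqdist_mpoly C n).
Proof.
move=> [g g0 hyp] Id.
have X0 : 'X_ord0 != 0 :> {mpoly C[1]} by rewrite -msize_poly_eq0 msizeX.
have [e] := mpoly_nonzero_point (mulf_neq0 g0 X0).
rewrite mevalM mevalXU mulf_eq0 negb_or => /andP[ge e0].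
have [q q1 offE] := hyp e ge; have [x qx] := nonconstant_mpoly_zero q1.
have : offset X (e 0 0) x by rewrite offE.
move=> /(_ 1); rewrite meval1 => one0.
exfalso; suff : (1 : C) = 0 by apply/eqP; rewrite oner_eq0.
rewrite -one0 // => w [z [Ez ze] _]; exfalso; move: ze => /= /eqP.
rewrite -meval_sqdist (Ez _ Id) sub0r oppr_eq0 expf_eq0 /=.
by rewrite (negbTE e0).
Qed.

Lemma offset_degree_nondominant (f : {mpoly C[n + 1]}) (P : {mpoly C[n]}) :
  P != 0 -> vanishing_ideal (normal_pairs X) (in_snd P) ->
  defining_polynomial (offset_family X) f ->
  degree_in (eps_index n) f = (2 * EDdegree X)%N.
Proof.
move=> P0 IP [_ If].
have PE z : ED_correspondence X z -> P.@[rsubmx z 0] = 0.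
  by move=> /(_ _ IP); rewrite -{1}(hsubmxK z) meval_in_snd.
rewrite (EDdegree_generic (m := 0%N)) ?muln0; last first.
  exists P => // y ny /=; rewrite II0 card_eq0; apply/eqP/seteqP.
  by split=> // z [/PE + zy]; rewrite zy => /eqP; rewrite (negbTE ny).
have [p pE] := to_univ_surj P%:P.
have : vanishing_ideal (offset_family X) p.
  by apply/vanishing_ideal_family => z e Ez _; rewrite pE eval_univC PE.
rewrite If => -[q pqf].
have : size (to_univ p) == 1%N by rewrite pE size_polyC P0.
rewrite pqf rmorphM size_mul_eq1 => /andP[_ /eqP s1].
have f0 : f != 0 by rewrite -to_univ_eq0 -size_poly_gt0 s1.
by have := size_to_univ f0; rewrite s1 => -[].
Qed.

End OffsetFamily.

(** * The dominant case *)

Lemma size_factor_le (A : idomainType) (p q r : {poly A}) :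
  r != 0 -> r = q * p -> (size p <= size r)%N.
Proof. by move=> r0 rE; apply: dvdp_leq; rewrite // rE dvdp_mulIr. Qed.

Section DominantCase.
Variables (C : numClosedFieldType) (n : nat) (X : set 'rV[C]_n).
Hypothesis X_irr : irreducible_variety X.
Variables (L : fieldType) (phi : {rmorphism {mpoly C[n + n]} -> L}).
Hypothesis phi_ker : forall p, phi p = 0 <-> vanishing_ideal (normal_pairs X) p.
Hypothesis normal_pairs0 : normal_pairs X !=set0.
Hypothesis snd_indep : forall P : {mpoly C[n]}, phi (in_snd P) = 0 -> P = 0.
Hypothesis sqdist_neq0 : phi (sqdist_mpoly C n) != 0.

Local Notation E := (ED_correspondence X).
Local Notation dist z := (sqdist (lsubmx z) (rsubmx z)).

Lemma phi_ker_ED p : phi p = 0 <-> forall z, E z -> p.@[z 0] = 0.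
Proof. by rewrite phi_ker -vanishing_ideal_closure. Qed.

Definition relation_eval : {poly {mpoly C[n]}} -> L := phi \o @at_dist C n.
HB.instance Definition _ := GRing.RMorphism.on relation_eval.

Lemma relation_evalC a : relation_eval a%:P = phi (in_snd a).
Proof. by rewrite /relation_eval /= at_distC. Qed.

Lemma relation_evalX : relation_eval 'X = phi (sqdist_mpoly C n).
Proof. by rewrite /relation_eval /= at_distX. Qed.

Lemma relation_eval_inj a : relation_eval a%:P = 0 -> a = 0.
Proof. by rewrite relation_evalC => /snd_indep. Qed.

Lemma relation_eval_eq0 h : relation_eval h = 0 <->
  forall z, E z -> eval_univ (rsubmx z) (dist z) h = 0.
Proof.
by split=> [/phi_ker_ED H z /H|H]; [|apply/phi_ker_ED => z /H];
  rewrite meval_at_dist.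
Qed.

Lemma eval_univ_even_odd (y : 'rV[C]_n) e h : eval_univ y e h =
  eval_univ y (e ^+ 2) (even_poly h) + eval_univ y (e ^+ 2) (odd_poly h) * e.
Proof.
rewrite -{1}(poly_even_odd h) rmorphD rmorphM /= eval_univX.
by congr (_ + _ * _); exact: eval_univ_comp_sqr.
Qed.

Lemma family_even_odd (f : {mpoly C[n + 1]}) :
  vanishing_ideal (offset_family X) f <->
  relation_eval (even_poly (to_univ f)) = 0 /\ relation_eval (odd_poly (to_univ f)) = 0.
Proof.
rewrite vanishing_ideal_family; split=> [If|]; last first.
  move=> [/relation_eval_eq0 Fe /relation_eval_eq0 Fo] z e Ez ze.
  by rewrite eval_univ_even_odd -ze Fe // Fo // mul0r addr0.
have H z : E z ->
  eval_univ (rsubmx z) (dist z) (even_poly (to_univ f)) = 0 /\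
  eval_univ (rsubmx z) (dist z) (odd_poly (to_univ f)) * dist z = 0.
  move=> Ez; pose e := sqrtC (dist z).
  have ze : dist z = e ^+ 2 by rewrite sqrtCK.
  have zN : dist z = (- e) ^+ 2 by rewrite sqrrN.
  have := If z e Ez ze; rewrite eval_univ_even_odd -ze.
  have := If z (- e) Ez zN; rewrite eval_univ_even_odd -zN mulrN.
  set a := eval_univ _ _ _; set b := eval_univ _ _ _.
  move=> /eqP; rewrite subr_eq0 => /eqP ->.
  rewrite -mulr2n => /eqP; rewrite mulrn_eq0 /= => /eqP be0.
  by rewrite be0 ze expr2 mulrA be0 mul0r.
split; first by apply/relation_eval_eq0 => z /H[].
have : relation_eval (odd_poly (to_univ f) * 'X) = 0.
  by apply/relation_eval_eq0 => z /H[_]; rewrite rmorphM /= eval_univX.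
rewrite rmorphM /= relation_evalX => /eqP; rewrite mulf_eq0 (negbTE sqdist_neq0) orbF.
by move=> /eqP.
Qed.

Lemma offset_degree_minimal (f : {mpoly C[n + 1]})
    (G : {poly {mpoly C[n]}}) :
  f != 0 -> vanishing_ideal (offset_family X) = [set p | exists q, p = q * f] ->
  minimal_relation relation_eval G -> degree_in (eps_index n) f = (2 * (size G).-1)%N.
Proof.
move=> f0 If [G0 PhiG minG].
suff : size (to_univ f) = (2 * (size G).-1).+1%N.
  by rewrite size_to_univ // => -[].
have G_gt0 : (0 < size G)%N by rewrite size_poly_gt0.
apply/eqP; rewrite eqn_leq; apply/andP; split.
  have [g gE] := to_univ_surj (G \Po 'X^2).
  have GX0 : G \Po 'X^2 != 0.
    by rewrite comp_poly_eq0 ?size_polyXn // negb_or G0.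
  have : vanishing_ideal (offset_family X) g.
    apply/vanishing_ideal_family => z e Ez ze.
    rewrite gE eval_univ_comp_sqr -ze; exact: (relation_eval_eq0 G).1.
  rewrite If => -[q gqf].
  have sGX : (size (G \Po 'X^2)).-1 = (2 * (size G).-1)%N.
    by rewrite size_comp_poly size_polyXn mulnC.
  rewrite -sGX prednK ?size_poly_gt0 //.
  by apply: (size_factor_le (q := to_univ q)); rewrite // -gE gqf rmorphM.
have : vanishing_ideal (offset_family X) f by rewrite If; exists 1; rewrite mul1r.
move=> /family_even_odd[Fe Fo].
have le_uphalf k s : (0 < k)%N -> (k <= uphalf s)%N -> ((2 * k.-1).+1 <= s)%N.
  by rewrite geq_uphalf_double -mul2n; case: k => // k _ /=; lia.
have [e0|/minG/(_ Fe) sG] := eqVneq (even_poly (to_univ f)) 0; last first.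
  apply: le_uphalf => //; exact: leq_trans sG (size_even_poly _).
have o0 : odd_poly (to_univ f) != 0.
  apply: contraNneq f0 => o0; rewrite -to_univ_eq0 -(poly_even_odd (to_univ f)).
  by rewrite e0 o0 comp_poly0 mul0r addr0.
apply: le_uphalf => //; apply: leq_trans (half_leq (leqnSn _)).
exact: leq_trans (minG _ o0 Fo) (size_odd_poly _).
Qed.

Definition coef_mderiv (j : 'I_n) : {poly {mpoly C[n]}} -> {poly {mpoly C[n]}} :=
  map_poly (mderiv j).

(* Differentiating [G(y, d) = 0] along the normal pairs kills the contribution of
   [dx], as [x - y] is normal to [X], and leaves [2 G'(y, d) (x - y) = grad_y G]. *)
Lemma foot_point_relation G j : relation_eval G = 0 ->
  relation_eval (coef_mderiv j G) = relation_eval (G^`() *+ 2) *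
    (phi 'X_(lshift n j) - phi 'X_(rshift n j)).
Proof.
move=> PhiG.
pose g := [tuple ('X_(rshift n i) : {mpoly C[n + n]}) | i < n].
have gE P : P \mPo g = in_snd P.
  apply: (mpoly_rmorph_ext (f := comp_mpoly g) (g := @in_snd C n)) => [c|i] /=.
    by rewrite comp_mpolyC in_sndC.
  by rewrite comp_mpolyXU in_sndX -tnth_nth tnth_mktuple.
have indep P : phi (P \mPo g) = 0 -> P = 0 by rewrite gE => /snd_indep.
have [v [vI vr]] := mpoly_derivation (rmorph_char0 phi) indep j.
have {}vr i : v (rshift n i) = (j == i)%:R.
  by rewrite -(vr i) tnth_mktuple -/(mpoly_der phi v _) mpoly_derX.
have Dd : mpoly_der phi v (sqdist_mpoly C n) =
    - (phi 'X_(lshift n j) - phi 'X_(rshift n j)) *+ 2.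
  rewrite /sqdist_mpoly (big_morph _ (mpoly_derD phi v) (_ : _ = 0)); last first.
    by rewrite -mpolyC0 mpoly_derC.
  pose a i : L := phi 'X_(lshift n i) - phi 'X_(rshift n i).
  rewrite (eq_bigr (fun i => (a i * v (lshift n i)) *+ 2 -
      (a i * (j == i)%:R) *+ 2)); last first.
    move=> i _; rewrite expr2 mpoly_derM mpoly_derD mpoly_derN !mpoly_derX vr.
    by rewrite rmorphB /a; ring.
  rewrite sumrB !sumrMnl (generic_normal_orthogonal X_irr phi_ker) //.
  rewrite mul0rn sub0r (bigD1 j) //= eqxx mulr1 big1 ?addr0 => [|i ij].
    by rewrite mulNrn.
  by rewrite eq_sym (negbTE ij) mulr0.
have DG : mpoly_der phi v (at_dist G) = relation_eval (coef_mderiv j G) +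
    relation_eval G^`() * mpoly_der phi v (sqdist_mpoly C n).
  rewrite -at_distX. apply: (chain_rule_univ (f := @at_dist C n) (phi := phi)
    (D := mpoly_der phi v) (delta := mderiv j)).
  - exact: mpoly_derD.
  - exact: mpoly_derM.
  - exact: mderivD.
  - exact: mderiv0.
  move=> a /=; rewrite !at_distC mpoly_der_chain; last exact: in_sndC.
  rewrite (bigD1 j) //= big1 => [|l lj]; last first.
    by rewrite in_sndX mpoly_derX vr eq_sym (negbTE lj) mulr0.
  by rewrite in_sndX mpoly_derX vr eqxx addr0 mulr1.
have := vI _ PhiG; rewrite -/(mpoly_der phi v _) DG Dd => /eqP.
rewrite addr_eq0 => /eqP ->; rewrite raddfMn /=.
by rewrite mulNrn mulrN opprK mulrnAr mulrnAl.
Qed.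

End DominantCase.

Lemma minimal_relation_specialize (A F : idomainType) (L : fieldType)
    (Phi : {rmorphism {poly A} -> L}) (G : {poly A})
    (alpha : {rmorphism {poly A} -> F}) (h : {poly A}) :
  minimal_relation Phi G -> alpha (lead_coef G)%:P != 0 -> alpha G = 0 ->
  Phi h = 0 -> alpha h = 0.
Proof.
move=> minG c0 aG /(minimal_relation_dvd minG)[k [q]].
rewrite -mul_polyC => /(congr1 alpha); rewrite !rmorphM aG mulr0 polyC_exp rmorphXn.
by move=> /eqP; rewrite mulf_eq0 (negbTE (expf_neq0 k c0)) => /eqP.
Qed.

Lemma minimal_relation_fraction (A F : idomainType) (L : fieldType)
    (Phi : {rmorphism {poly A} -> L}) (G : {poly A})
    (alpha : {rmorphism {poly A} -> F}) (b w s : {poly A}) k x :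
  minimal_relation Phi G -> alpha (lead_coef G)%:P != 0 -> alpha G = 0 ->
  alpha w != 0 -> Phi b = Phi w ^+ k * Phi s -> alpha b = alpha w ^+ k * x ->
  x = alpha s.
Proof.
move=> minG c0 aG w0 Phib ab; have Phi0 : Phi (b - w ^+ k * s) = 0.
  by rewrite rmorphB rmorphM rmorphXn Phib subrr.
have := minimal_relation_specialize minG c0 aG Phi0.
rewrite rmorphB rmorphM rmorphXn ab => /eqP.
by rewrite subr_eq0 => /eqP/(mulfI (expf_neq0 k w0)).
Qed.

Lemma specialized_roots (A : idomainType) (K : closedFieldType)
    (ev : {rmorphism A -> K}) (G U V : {poly A}) (r : A) :
  r%:P = U * G + V * G^`() -> ev (lead_coef G) != 0 -> ev r != 0 ->
  exists rs : seq K, [/\ uniq rs, size rs = (size G).-1,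
    forall t, (t \in rs) = root (map_poly ev G) t &
    forall t, t \in rs -> (map_poly ev G^`()).[t] != 0].
Proof.
move=> rE c0 r0; set G0 := map_poly ev G.
have G0' : map_poly ev G^`() = G0^`() by rewrite deriv_map.
have sG : size G0 = size G by rewrite size_map_poly_id0.
have bez : (ev r)%:P = map_poly ev U * G0 + map_poly ev V * G0^`().
  by rewrite -G0' -!rmorphM -rmorphD -rE /= map_polyC.
have [rs G0E] := closed_field_poly_normal G0.
have l0 : lead_coef G0 != 0.
  rewrite lead_coef_eq0 -size_poly_gt0 sG size_poly_gt0 -lead_coef_eq0.
  by apply: contraNneq c0 => ->; rewrite rmorph0.
have rsE t : (t \in rs) = root G0 t by rewrite G0E rootZ // root_prod_XsubC.
exists rs; split=> // [||t].
- rewrite -separable_prod_XsubC.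
  have : separable_poly G0.
    rewrite separable_poly.unlock; apply/Bezout_coprimepP.
    exists (map_poly ev U, map_poly ev V) => /=.
    by rewrite -bez polyC_eqp1.
  by rewrite G0E !separable_poly.unlock derivZ coprimepZl // coprimepZr.
- by rewrite -sG G0E size_scale // size_prod_XsubC.
rewrite rsE => /rootP G0t; rewrite G0'; apply: contraNneq r0 => G0't.
by rewrite -(hornerC (ev r) t) bez !hornerE G0t G0't !mulr0 addr0.
Qed.

Section FiberCount.
Variables (C : numClosedFieldType) (n : nat) (X : set 'rV[C]_n).
Hypothesis X_irr : irreducible_variety X.
Variables (L : fieldType) (phi : {rmorphism {mpoly C[n + n]} -> L}).
Hypothesis phi_ker : forall p, phi p = 0 <-> vanishing_ideal (normal_pairs X) p.
Hypothesis normal_pairs0 : normal_pairs X !=set0.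
Hypothesis snd_indep : forall P : {mpoly C[n]}, phi (in_snd P) = 0 -> P = 0.
Variable G : {poly {mpoly C[n]}}.
Hypothesis minG : minimal_relation (relation_eval phi) G.

Local Notation E := (ED_correspondence X).

Let PhiG : relation_eval phi G = 0. Proof. by case: minG. Qed.

Definition foot (y : 'rV[C]_n) (t : C) : 'rV[C]_n :=
  \row_j (y 0 j + eval_univ y t (coef_mderiv j G) / eval_univ y t (G^`() *+ 2)).

Lemma meval_foot (y : 'rV[C]_n) t p s :
  (lead_coef G).@[y 0] != 0 -> eval_univ y t G = 0 ->
  eval_univ y t G^`() != 0 -> phi p = relation_eval phi s ->
  p.@[row_mx (foot y t) y 0] = eval_univ y t s.
Proof.
move=> cy Gt G't ps; pose w := G^`() *+ 2.
have w0 : eval_univ y t w != 0 by rewrite rmorphMn mulrn_eq0.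
pose u (k : 'I_(n + n)) : {poly {mpoly C[n]}} := match split k with
  | inl j => w * ('X_j)%:P + coef_mderiv j G
  | inr j => w * ('X_j)%:P end.
have ul j : u (lshift n j) = w * ('X_j)%:P + coef_mderiv j G.
  by rewrite /u (unsplitK (inl j)).
have ur j : u (rshift n j) = w * ('X_j)%:P by rewrite /u (unsplitK (inr j)).
have [k [b bE]] := clear_denominators (polyC \o @mpolyC n C)%FUN w u p.
have PhiE : relation_eval phi b = relation_eval phi w ^+ k * phi p.
  apply: bE => [c|i] /=; first by rewrite relation_evalC in_sndC.
  case: (split_ordP i) => j ->.
    rewrite ul [RHS]rmorphD [X in X + _]rmorphM /=.
    rewrite relation_evalC in_sndX.
    rewrite (foot_point_relation X_irr phi_ker normal_pairs0 snd_indep j PhiG).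
    by rewrite -mulrDr addrC subrK.
  by rewrite ur [RHS]rmorphM /= relation_evalC in_sndX.
have evE : eval_univ y t b =
    eval_univ y t w ^+ k * p.@[row_mx (foot y t) y 0].
  apply: (bE _ (eval_univ y t) (meval (row_mx (foot y t) y 0))) => [c|i] /=.
    by rewrite mevalC eval_univC mevalC.
  rewrite mevalXU; case: (split_ordP i) => j ->.
    rewrite ul row_mxEl mxE [RHS]rmorphD [X in _ = X + _]rmorphM /=.
    by rewrite eval_univC mevalXU mulrDr -/w [X in _ + X]mulrC divfK.
  by rewrite ur row_mxEr [RHS]rmorphM /= eval_univC mevalXU.
have cyP : eval_univ y t (lead_coef G)%:P != 0 by rewrite eval_univC.
rewrite ps in PhiE.
exact: (minimal_relation_fraction (alpha := eval_univ y t) minG cyP Gt w0 PhiE evE).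
Qed.

Lemma fiber_card : generically [set y0 |
  ([set z | E z /\ rsubmx z = y0] #= `I_(size G).-1)%card].
Proof.
have [r [U [V [r0 rE]]]] :=
  minimal_relation_bezout (rmorph_char0 phi) (relation_eval_inj snd_indep) minG.
exists (lead_coef G * r) => [|y].
  by rewrite mulf_neq0 // lead_coef_eq0; case: minG.
rewrite mevalM mulf_eq0 negb_or => /andP[cy ry] /=.
have [rs [uniq_rs size_rs rsE rs']] := specialized_roots rE cy ry.
pose F (i : nat) := row_mx (foot y rs`_i) y.
have rootE t : t \in rs -> eval_univ y t G = 0 by rewrite rsE => /rootP.
have footE p s t : t \in rs -> phi p = relation_eval phi s ->
    p.@[row_mx (foot y t) y 0] = eval_univ y t s.
  by move=> ts; apply: meval_foot => //; [exact: rootE | exact: rs'].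
have dist_foot t : t \in rs -> sqdist (foot y t) y = t.
  move=> ts; have := footE (sqdist_mpoly C n) 'X t ts.
  rewrite meval_sqdist row_mxKl row_mxKr eval_univX; apply.
  by rewrite relation_evalX.
have -> : [set z | E z /\ rsubmx z = y] = F @` `I_(size G).-1.
  apply/seteqP; split=> [z [Ez zy]|_ [i /= lti <-]]; last first.
    have ts : rs`_i \in rs by rewrite mem_nth // size_rs.
    rewrite /F row_mxKr; split=> // p /phi_ker p0.
    by rewrite (footE p 0) ?rmorph0.
  pose t := sqdist (lsubmx z) y.
  have ts : t \in rs.
    rewrite rsE; apply/rootP; rewrite -[LHS]/(eval_univ y t G) /t -{2}zy -zy.
    exact: (relation_eval_eq0 phi_ker G).1.
  exists (index t rs); first by rewrite /= -size_rs index_mem.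
  rewrite /F nth_index // -[RHS]hsubmxK zy; congr row_mx.
  apply/rowP => j; rewrite mxE.
  have G't : eval_univ y t (G^`() *+ 2) != 0.
    by rewrite rmorphMn mulrn_eq0 /=; exact: rs'.
  have foot0 : phi (at_dist (coef_mderiv j G) - at_dist (G^`() *+ 2) *
      ('X_(lshift n j) - 'X_(rshift n j))) = 0.
    rewrite (rmorphB phi) (rmorphM phi (at_dist (G^`() *+ 2))) (rmorphB phi).
    apply/eqP; rewrite subr_eq0; apply/eqP.
    exact: (foot_point_relation X_irr phi_ker normal_pairs0 snd_indep j PhiG).
  have : eval_univ y t (coef_mderiv j G) =
      eval_univ y t (G^`() *+ 2) * (lsubmx z 0 j - y 0 j).
    apply/eqP; rewrite -subr_eq0; apply/eqP.
    have := (phi_ker_ED phi_ker _).1 foot0 z Ez.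
    rewrite mevalB mevalM !meval_at_dist mevalB !mevalXU zy -/t => <-.
    by rewrite (_ : y 0 j = z 0 (rshift n j)) -?zy !mxE.
  by move=> ->; rewrite mulrAC mulfV // mul1r addrC subrK.
apply: inj_card_eq => i k; rewrite !inE /= => lti ltk /eq_row_mx[].
move=> /(congr1 (fun x : 'rV[C]_n => sqdist x y)).
rewrite !dist_foot ?mem_nth ?size_rs // => /eqP.
by rewrite nth_uniq ?size_rs // => /eqP.
Qed.

End FiberCount.

Theorem theorem2p9 (R : realType) (n : nat) (X : set 'rV[R[i]]_n)
    (f : {mpoly R[i][n + 1]})
    (X_irr : irreducible_variety X)
    (offset_hyp :
       generically [set e : 'rV[R[i]]_1 | hypersurface (offset X (e 0 0))])
    (family_hyp : hypersurface (offset_family X))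
    (f_def : defining_polynomial (offset_family X) f) :
  degree_in (eps_index n) f = (2 * EDdegree X)%N.
Proof.
have [S0|/set0P S_neq0] := eqVneq (normal_pairs X) set0.
  apply: (offset_degree_nondominant (P := 1)) => //; first exact: oner_neq0.
  by move=> z; rewrite S0.
have [L [phi phi_ker]] := vanishing_ideal_field S_neq0
  (fun p q => @normal_pairs_prime _ _ X X_irr p q).
have [[P [P0 IP]]|indep] :=
    pselect (exists P : {mpoly R[i][n]}, P != 0 /\ phi (in_snd P) = 0).
  by apply: (offset_degree_nondominant P0) => //; apply/phi_ker.
have {}indep (P : {mpoly R[i][n]}) : phi (in_snd P) = 0 -> P = 0.
  by move=> IP; apply/eqP/negPn/negP => P0; apply: indep; exists P.
have d0 : phi (sqdist_mpoly _ n) != 0.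
  by apply/eqP => /phi_ker; exact: sqdist_not_vanishing.
have [_ If] := f_def.
have f0 : f != 0.
  have [g g1 gE] := family_hyp.
  have : vanishing_ideal (offset_family X) g by rewrite gE.
  rewrite If => -[q gq]; apply/eqP => f0.
  by move: g1; rewrite gq f0 mulr0 msize0.
have : vanishing_ideal (offset_family X) f by rewrite If; exists 1; rewrite mul1r.
move=> /(family_even_odd phi_ker d0)[Fe Fo].
have [G minG] : exists G, minimal_relation (relation_eval phi) G.
  have [e0|] := eqVneq (even_poly (to_univ f)) 0; last first.
    by move=> e0; apply: ex_minimal_relation Fe.
  apply: (ex_minimal_relation _ Fo); apply: contraNneq f0 => o0.
  rewrite -to_univ_eq0 -(poly_even_odd (to_univ f)).
  by rewrite e0 o0 comp_poly0 mul0r addr0.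
rewrite (offset_degree_minimal phi_ker d0 f0 If minG); congr (2 * _)%N.
apply/esym/EDdegree_generic.
exact: (fiber_card X_irr phi_ker S_neq0 indep minG).
Qed.
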